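(* The Thurston set $\Omega_2^{cp}$ and the postcritically finite Thurston set $\Omega_2^{pcf}$ are not equal.
   Context: A unimodal map is a continuous self-map of a compact real interval with exactly one turning point, called its critical point. It is critically periodic if the critical point is a fixed point of some forward iterate $f^n$, $n\ge1$, and postcritically finite if the forward orbit of the critical point is a finite set. $\mathcal{F}^{cp}$ (resp. $\mathcal{F}^{pcf}$) denotes the family of critically periodic (resp. postcritically finite) unimodal continuous self-maps of compact real intervals. The growth rate of $f$ is $\lambda(f)=e^{h_{top}(f)}$, where $h_{top}$ is topological entropy; for $f\in\mathcal{F}^{pcf}$ it is an algebraic integer. The Galois conjugates of $\lambda$ are all the complex roots of its minimal polynomial over $\mathbb{Q}$. Define $$\Omega_2^{cp}:=\overline{\{z\in\mathbb{C}\mid \lambda=\lambda(f)\text{ for some }f\in\mathcal{F}^{cp},\ z\text{ is a Galois conjugate of }\lambda\}},$$ $$\Omega_2^{pcf}:=\overline{\{z\in\mathbb{C}\mid \lambda=\lambda(f)\text{ for some }f\in\mathcal{F}^{pcf},\ z\text{ is a Galois conjugate of }\lambda\}}.$$ *)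

(* Defs.v *)
From mathcomp Require Import all_boot all_order all_algebra complex.
From mathcomp Require Import all_classical all_reals all_analysis.

Set Implicit Arguments.
Unset Strict Implicit.
Unset Printing Implicit Defensive.

Import Order.TTheory GRing.Theory Num.Theory numFieldNormedType.Exports.
Local Open Scope classical_set_scope.
Local Open Scope ring_scope.
Local Open Scope complex_scope.

(* Maps of a compact interval [a, b] are represented by total functions
   [f : R -> R]; every notion below depends only on [f] restricted to
   [a, b]. *)

Definition strictly_increasing_on (R : realType) (I : interval R)
    (f : R -> R) : Prop :=
  {in I &, {homo f : x y / x < y}}.

Definition strictly_decreasing_on (R : realType) (I : interval R)
    (f : R -> R) : Prop :=
  {in I &, {homo f : x y / x < y >-> y < x}}.

(* Turning points in the sense of Milnor and Thurston: the interior points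
   where [f] passes from strictly increasing to strictly decreasing or
   conversely.  Having [c] as only turning point means having exactly the two
   maximal intervals of monotonicity [a, c] and [c, b], on which [f] has
   opposite senses. *)
Definition unimodal (R : realType) (a b : R) (f : R -> R) (c : R) : Prop :=
  [/\ a < c < b,
      {within `[a, b], continuous f},
      (forall x, x \in `[a, b] -> f x \in `[a, b]) &
      (strictly_increasing_on `[a, c] f /\ strictly_decreasing_on `[c, b] f) \/
      (strictly_decreasing_on `[a, c] f /\ strictly_increasing_on `[c, b] f)].

Definition critically_periodic (R : realType) (f : R -> R) (c : R) : Prop :=
  exists2 n : nat, (0 < n)%N & iter n f c = c.

Definition postcritically_finite (R : realType) (f : R -> R) (c : R) : Prop :=
  finite_set [set iter n f c | n in [set: nat]].

(* Topological entropy of [f] on an invariant compact set [K], in the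
   Bowen-Dinaburg form:
     h = sup_{e > 0} limsup_n (1/n) log s(n, e),
   where s(n, e) is the largest cardinality of an (n, e)-separated subset of K.
   The inner limsup is nonincreasing in e, so the supremum over e is the limit
   as e tends to 0. *)
Definition dynamically_separated (R : realType) (K : set R) (f : R -> R) (n : nat) (e : R)
    (s : seq R) : Prop :=
  [/\ uniq s, (forall x, x \in s -> K x) &
      forall x y, x \in s -> y \in s -> x != y ->
        exists2 k : nat, (k < n)%N & e < `|iter k f x - iter k f y|].

Definition max_separated (R : realType) (K : set R) (f : R -> R) (n : nat)
    (e : R) : \bar R :=
  ereal_sup [set ((size s)%:R)%:E | s in [set s | dynamically_separated K f n e s]].

Definition entropy (R : realType) (K : set R) (f : R -> R) : \bar R :=
  ereal_sup
    [set limn_esup (fun n => (n%:R^-1)%:E * lne (max_separated K f n e))%E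
       | e in [set e : R | 0 < e]].

Definition growth_rate (R : realType) (a b : R) (f : R -> R) : \bar R :=
  expeR (entropy `[a, b] f).

Definition minimal_polynomial (F : fieldType) (x : F) (p : {poly rat}) : Prop :=
  [/\ p \is monic, root (map_poly ratr p) x &
      forall q : {poly rat}, q != 0 -> root (map_poly ratr q) x ->
        (size p <= size q)%N].

Definition galois_conjugate (R : realType) (lam : R) (z : R[i]) : Prop :=
  exists2 p : {poly rat},
    minimal_polynomial lam p & root (map_poly ratr p) z.

Definition conjugates_cp (R : realType) : set R[i] :=
  [set z | exists (a b : R) (f : R -> R) (c lam : R),
     [/\ unimodal a b f c, critically_periodic f c,
         growth_rate a b f = lam%:E & galois_conjugate lam z]].

Definition conjugates_pcf (R : realType) : set R[i] :=
  [set z | exists (a b : R) (f : R -> R) (c lam : R),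
     [/\ unimodal a b f c, postcritically_finite f c,
         growth_rate a b f = lam%:E & galois_conjugate lam z]].

Arguments conjugates_cp R _ : clear implicits.
Arguments conjugates_pcf R _ : clear implicits.

(* [R[i]^o] is [R[i]] with the topology of its modulus. *)
Definition Omega_cp (R : realType) : set R[i]^o :=
  closure (conjugates_cp R : set R[i]^o).

Definition Omega_pcf (R : realType) : set R[i]^o :=
  closure (conjugates_pcf R : set R[i]^o).

Arguments Omega_cp R _ : clear implicits.
Arguments Omega_pcf R _ : clear implicits.

(* Main.v *)
(** For a critically periodic unimodal map with growth rate [lam > 1], counting
    the turning points of the iterates gives a kneading identity which forces
    [1 / lam] to be a root of a polynomial with coefficients [1] and [-1]; hence
    all Galois conjugates of [lam] are roots of such polynomials.  For the tent
    map [x |-> 1 - s |x|], the growth rate is the slope [s].  The real root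
    [s = 1.8445] of the polynomial [X^10 - 2X^7 - 4X^6 - 4X^5 - 4X^4 - 2X^3 -
    2X^2 - 2], irreducible by Eisenstein's criterion at [2], gives a preperiodic
    turning point, and this polynomial also has a root near [0.5026 + 0.5320 i].
    No power series with coefficients [1] and [-1] vanishes near this root:
    in the tree of the partial sums, every branch leaves within [18] steps the
    disk in which the rest of the series could still cancel the sum. *)

From Stdlib Require Import ZArith.
Require Import Defs.
From mathcomp Require Import all_boot all_order all_algebra complex.
From mathcomp Require Import all_classical all_reals all_analysis.
From mathcomp Require Import ring lra polyrcf zify ssrZ.

Set Implicit Arguments.
Unset Strict Implicit.
Unset Printing Implicit Defensive.

Import Order.TTheory GRing.Theory Num.Theory numFieldNormedType.Exports.
Local Open Scope classical_set_scope.
Local Open Scope ring_scope.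

(* MathComp uses the key [Z] for [int]. *)
Delimit Scope Z_scope with BZ.

(** * Kneading theory of unimodal maps *)

(** Growth rates are defined by separated sets, the kneading identity by lap numbers, so both must
    be compared. Few laps give few separated points through total variation. The converse is harder,
    since the map need not expand and distinct itineraries need not be separated; but a small Bowen
    ball meets at most three itineraries per block of [M] steps, and the cube root [3^(1/M)] type
    loss vanishes as [M] grows. Periodicity of the turning point makes the signs [theta] periodic,
    so their series is a polynomial with coefficients 1 and -1 divided by [1 - t^p]. A preperiodic
    turning point gives no such polynomial: for the witness, [x_12 = - x_10] along the orbit, and
    adding two polynomials with coefficients 1 and -1 produces 0 and 2. Modulo 2 only the two top
    terms [s^11 + s^10 = (s - 1) s^10] survive, whence Eisenstein's condition once [s - 1] is
    divided out. Because of the closure, a whole disk must be free of zeros of signed polynomials of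
    every degree. Continuing the signs periodically divides such a polynomial by [1 - z^n], so one
    finite tree of power series serves all degrees, and a margin in the escape test serves the whole
    disk. *)

Section Folding.
Variables (R : realType) (f : R -> R) (c : R).

Definition strictly_between (u v : R) := (u < c < v) || (v < c < u).

(* [turns k u v] is the number of points strictly between [u] and [v] whose
   first visit to [c] takes place at time [k]. *)
Fixpoint turns (k : nat) (u v : R) : nat :=
  if k is k'.+1 then
    if strictly_between u v then (turns k' (f u) (f c) + turns k' (f c) (f v))%N
    else turns k' (f u) (f v)
  else strictly_between u v.

Definition laps (n : nat) (u v : R) : nat := (\sum_(k < n) turns k u v).+1.

Lemma strictly_betweenC u v : strictly_between u v = strictly_between v u.
Proof. by rewrite /strictly_between orbC. Qed.

Lemma turnsC k u v : turns k u v = turns k v u.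
Proof.
elim: k u v => [|k IH] u v /=; first by rewrite strictly_betweenC.
rewrite strictly_betweenC [in RHS]addnC; case: ifP => _; last exact: IH.
by congr addn; apply: IH.
Qed.

Lemma lapsC n u v : laps n u v = laps n v u.
Proof. by congr S; apply: eq_bigr => k _; rewrite turnsC. Qed.

Lemma laps0 u v : laps 0 u v = 1%N.
Proof. by rewrite /laps big_ord0. Qed.

Lemma lapsS n u v : laps n.+1 u v =
  if strictly_between u v then (laps n (f u) (f c) + laps n (f c) (f v))%N
  else laps n (f u) (f v).
Proof.
rewrite /laps big_ord_recl /=; case: ifP => h; last by rewrite add0n.
by rewrite big_split /= addSn addnS.
Qed.

Lemma leq_laps u v : {homo laps^~ u ^~ v : m n / (m <= n)%N}.
Proof.
move=> m n mn; rewrite ltnS -(subnKC mn) big_split_ord /=; exact: leq_addr.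
Qed.

(* A germ is a point together with a direction ([true] is rightwards). *)
Definition left_germ (x : R) (up : bool) := (x < c) || ((x == c) && ~~ up).

Variable inc : bool.

(* [inc] tells whether [f] increases to the left of [c]. *)
Definition increasing_germ x up := left_germ x up == inc.

Definition sgb (d : bool) : R := if d then 1 else -1.

(* The sign of the slope of [iter m.+1 f] along the germ. *)
Fixpoint theta (m : nat) (x : R) (up : bool) : R :=
  let d := increasing_germ x up in
  if m is m'.+1 then sgb d * theta m' (f x) (d == up) else sgb d.

Fixpoint direction (i : nat) (x : R) (up : bool) : bool :=
  if i is i'.+1 then direction i' (f x) (increasing_germ x up == up) else up.

Lemma left_germ_turn up : left_germ c up = ~~ up.
Proof. by rewrite /left_germ ltxx eqxx. Qed.

(** The two germs at [c] have the same image germ at [f c], and [f] increases along exactly one of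
    them. *)
Lemma theta_turn m : theta m c true = - theta m c false.
Proof.
case: m => [|m] /=; rewrite /increasing_germ !left_germ_turn /=;
by case: inc => /=; rewrite /sgb ?mul1r ?mulN1r ?opprK.
Qed.

Lemma sqr_theta m x up : theta m x up ^+ 2 = 1.
Proof.
elim: m x up => [|m IH] x up /=; first by rewrite /sgb; case: ifP; rewrite ?sqrrN expr1n.
by rewrite exprMn IH /sgb; case: ifP; rewrite ?sqrrN expr1n mulr1.
Qed.

Lemma theta_pm1 m x up : theta m x up = 1 \/ theta m x up = -1.
Proof.
have /eqP := sqr_theta m x up; rewrite sqrf_eq1 => /orP[] /eqP; by [left|right].
Qed.

Lemma theta_add i j x up : theta (i + j) x up =
  sgb (direction i x up == up) * theta j (iter i f x) (direction i x up).
Proof.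
elim: i x up => [|i IH] x up /=; first by rewrite eqxx mul1r.
rewrite IH -iterS iterSr mulrA; congr (_ * _).
by case: (direction _ _ _); case: (increasing_germ x up); case: up;
  rewrite /sgb /= ?mul1r ?mulr1 ?mulN1r ?opprK.
Qed.

(** The germ may come back to [c] on either side. On the opposite side, the sign of [iter p f] and
    the sign from [theta_turn] are both -1 and cancel, so the period is [p] and never [2 p]. *)
Lemma theta_periodic p j : iter p f c = c ->
  theta (p + j) c false = theta j c false.
Proof.
move=> pc; rewrite theta_add pc; case: (direction _ _ _) => /=; last by rewrite mul1r.
by rewrite theta_turn mulN1r opprK.
Qed.

Variables (a b : R).

Definition folding := [/\ a < c < b,
  (forall x, a <= x <= b -> a <= f x <= b),
  (forall x y, a <= x -> x < y -> y <= c -> if inc then f x < f y else f y < f x) &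
  (forall x y, c <= x -> x < y -> y <= b -> if inc then f y < f x else f x < f y)].

Hypothesis fold : folding.

Lemma folding_map x : a <= x <= b -> a <= f x <= b.
Proof. by case: fold => _ h _ _; apply: h. Qed.

Lemma folding_turn : a <= c <= b.
Proof. by case: fold => /andP[/ltW -> /ltW ->]. Qed.

Lemma folding_mono u v : a <= u -> u < v -> v <= b -> ~~ strictly_between u v ->
  if increasing_germ u true then f u < f v else f v < f u.
Proof.
case: fold => _ _ hl hr au uv vb; rewrite /strictly_between negb_or => /andP[h _].
rewrite /increasing_germ /left_germ andbF orbF.
have [uc|cu] := ltP u c; last by have := hr _ _ cu uv vb; case: inc.
have vc : v <= c by move: h; rewrite uc /= -leNgt.
by have := hl _ _ au uv vc; case: inc.
Qed.

Lemma left_germ_side u v : u < v -> ~~ strictly_between u v ->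
  left_germ u true = left_germ v false.
Proof.
move=> uv; rewrite /strictly_between negb_or /left_germ andbF orbF andbT => /andP[h _].
rewrite orbC -le_eqVlt.
by have [uc|cu] := ltP u c; [move: h; rewrite uc /= -leNgt => -> |
  rewrite leNgt (le_lt_trans cu uv)].
Qed.

(* The sign of the slope jumps at the turning points only, by an amount which
   depends only on their time of first visit to [c]. *)
Lemma theta_turns m u v : a <= u -> u < v -> v <= b ->
  theta m u true - theta m v false =
  2 * \sum_(k < m.+1) (turns k u v)%:R * theta (m - k) c false.
Proof.
elim: m u v => [|m IH] u v au uv vb.
  rewrite big_ord1 subn0 /=; case sb: (strictly_between u v).
    have {sb} /andP[uc cv] : u < c < v.
      move: sb => /orP[//|/andP[vc cu]].
      by have := lt_trans (lt_trans uv vc) cu; rewrite ltxx.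
    rewrite /increasing_germ left_germ_turn /left_germ uc /=.
    rewrite (gt_eqF cv) ltNge (ltW cv) /= /sgb.
    by case: inc => /=; ring.
  rewrite /= mul0r mulr0 /increasing_germ (@left_germ_side u v) ?sb // subrr //.
(* Within one lap, the induction hypothesis applies to the images; if [f] decreases there, it
   exchanges the endpoints, which the sign -1 of the slope compensates. *)
have step w z : a <= w -> w < z -> z <= b -> ~~ strictly_between w z ->
    theta m.+1 w true - theta m.+1 z false =
    2 * \sum_(k < m.+1) (turns k (f w) (f z))%:R * theta (m - k) c false.
  move=> aw wz zb nsb.
  have /andP[afw fwb] : a <= f w <= b by rewrite folding_map // aw (ltW (lt_le_trans wz zb)).
  have /andP[afz fzb] : a <= f z <= b by rewrite folding_map // zb (ltW (le_lt_trans aw wz)).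
  have := folding_mono aw wz zb nsb; rewrite /= /increasing_germ -(left_germ_side wz nsb).
  case: eqP => _ /= lt; rewrite /sgb.
    by rewrite !mul1r IH.
  rewrite !mulN1r opprK addrC IH //; congr (2 * _); apply: eq_bigr => k _.
  by rewrite turnsC.
rewrite big_ord_recl subn0 [turns 0 u v]/=.
have shift : \sum_(i < m.+1) (turns (bump 0 i) u v)%:R * theta (m.+1 - bump 0 i) c false
   = \sum_(i < m.+1) (turns i.+1 u v)%:R * theta (m - i) c false by [].
rewrite shift.
case sb: (strictly_between u v); last first.
  rewrite mul0r add0r step ?sb //; congr (2 * _); apply: eq_bigr => k _.
  by rewrite /= sb.
have {}sb' : u < c < v.
  move: sb => /orP[//|/andP[vc cu]].
  by have := lt_trans (lt_trans uv vc) cu; rewrite ltxx.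
case/andP: sb' => uc cv; case/andP: folding_turn => ac cb.
have nu : ~~ strictly_between u c by rewrite /strictly_between ltxx !andbF.
have nv : ~~ strictly_between c v by rewrite /strictly_between ltxx !andbF.
have E1 := step _ _ au uc cb nu; have E2 := step _ _ ac cv vb nv.
have -> : \sum_(i < m.+1) (turns i.+1 u v)%:R * theta (m - i) c false =
    \sum_(k < m.+1) (turns k (f u) (f c))%:R * theta (m - k) c false +
    \sum_(k < m.+1) (turns k (f c) (f v))%:R * theta (m - k) c false.
  rewrite -big_split; apply: eq_bigr => k _ /=.
  by rewrite sb natrD mulrDl.
have E3 := theta_turn m.+1.
rewrite mul1r !mulrDr addrA -E1 -E2 [in RHS]addrA E3; ring.
Qed.

(** By [theta_turns], the convolution is half the difference of two signs. The product of the
    turning series and the kneading series thus has bounded coefficients, the only form of the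
    kneading identity needed later. *)
Lemma kneading_bound m :
  `|\sum_(k < m.+1) (turns k a b)%:R * theta (m - k) c false| <= 1.
Proof.
case: fold => /andP[ac cb] _ _ _.
have := theta_turns m (lexx a) (lt_trans ac cb) (lexx b).
rewrite ler_norml; case: (theta_pm1 m a true) (theta_pm1 m b false) => -> [] ->;
move=> *; apply/andP; split; lra.
Qed.

End Folding.

(** * Separated sets and total variation *)

Lemma limn_esup_le_near (R : realType) (u : nat -> \bar R) (l : \bar R) (N : nat) :
  (forall n, (N <= n)%N -> (u n <= l)%E) -> (limn_esup u <= l)%E.
Proof.
move=> h; apply: (@le_trans _ _ (ereal_sup (u @` [set n | (N <= n)%N]))).
  by apply: ereal_inf_lbound; exists [set n | (N <= n)%N] => //; exists N.
by apply: ub_ereal_sup => _ [n Nn <-]; exact: h.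
Qed.

Lemma limn_esup_lt_near (R : realType) (u : nat -> \bar R) (l : \bar R) :
  (limn_esup u < l)%E -> exists N, forall n, (N <= n)%N -> (u n < l)%E.
Proof.
move=> /ereal_inf_lt [_ [V [N _ NV] <-] ltl]; exists N => n Nn.
by apply: le_lt_trans ltl; apply: ereal_sup_ubound; exists n => //; exact: NV.
Qed.

Section Entropy.
Variables (R : realType) (K : set R) (f : R -> R).

Lemma max_separated_ge0 n e : (0 <= max_separated K f n e)%E.
Proof.
by apply: ereal_sup_ubound; exists [::] => //; split => // x; rewrite in_nil.
Qed.

Lemma max_separated_ge1 n e : K !=set0 -> (1 <= max_separated K f n e)%E.
Proof.
case=> x Kx; apply: ereal_sup_ubound; exists [:: x] => //; split => //.
  by move=> y /[!inE] /eqP ->.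
by move=> y z /[!inE] /eqP -> /eqP ->; rewrite eqxx.
Qed.

Lemma entropy_ge0 : K !=set0 -> (0 <= entropy K f)%E.
Proof.
move=> K0; apply: ereal_sup_ge; exists (limn_esup (fun n =>
  (n%:R^-1)%:E * lne (max_separated K f n 1))%E); first by exists 1 => //=.
apply: limf_esup_ge0; first by case=> N _ /(_ N) /=; rewrite leqnn => /(_ isT).
move=> n; apply: mule_ge0; first by rewrite lee_fin invr_ge0.
by rewrite lne_ge0 max_separated_ge1.
Qed.

Lemma entropy_le_ln (r : R) : 1 <= r ->
  (forall e, 0 < e -> exists C : R, forall n, (max_separated K f n e <= (C * r ^+ n)%:E)%E) ->
  (entropy K f <= (ln r)%:E)%E.
Proof.
move=> r1 h; apply: ub_ereal_sup => _ [e /= e0 <-].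
have [C0 hC0] := h e e0; pose C := Num.max C0 1.
have C1 : 1 <= C by rewrite le_max lexx orbT.
have hC n : (max_separated K f n e <= (C * r ^+ n)%:E)%E.
  apply: le_trans (hC0 n) _; rewrite lee_fin ler_wpM2r ?le_max ?lexx //.
  by rewrite exprn_ge0 // (le_trans ler01).
have r0 : 0 < r by apply: lt_le_trans r1.
have C0' : 0 < C by apply: lt_le_trans C1.
apply/lee_addgt0Pr => d d0.
apply: (@limn_esup_le_near _ _ _ (Num.truncn (ln C / d)).+1) => n Nn.
have n0 : 0 < n%:R :> R by rewrite ltr0n; case: n Nn.
apply: (@le_trans _ _ ((n%:R^-1)%:E * (ln (C * r ^+ n))%:E)%E).
  rewrite lee_pmul2l ?lte_fin ?invr_gt0 //.
  rewrite -lne_EFin ?mulr_gt0 ?exprn_gt0 // -lee_expeR.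
  by rewrite !lneK ?in_itv /= ?leey ?andbT ?max_separated_ge0 // lee_fin ltW // mulr_gt0 // exprn_gt0.
rewrite -EFinM -EFinD lee_fin lnM ?posrE ?exprn_gt0 // lnXn // mulrDr -[ln r *+ n]mulr_natl.
rewrite (mulrA _ n%:R) mulVf ?gt_eqF // mul1r addrC lerD2l ler_pdivrMl //.
rewrite mulrC -ler_pdivrMl // mulrC.
apply: le_trans (ltW (truncnS_gt _)) _; by rewrite ler_nat.
Qed.

Lemma lt_entropy (r e : R) : 0 < e -> 0 < r -> (entropy K f < (ln r)%:E)%E ->
  exists N, forall n, (N <= n)%N -> (max_separated K f n e < (r ^+ n)%:E)%E.
Proof.
move=> e0 r0 hlt.
have /limn_esup_lt_near [N hN] : (limn_esup (fun n =>
    (n%:R^-1)%:E * lne (max_separated K f n e)) < (ln r)%:E)%E.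
  by apply: le_lt_trans hlt; apply: ereal_sup_ubound; exists e.
exists N.+1 => n Nn; have := hN n (ltnW Nn).
have n0 : 0 < n%:R :> R by rewrite ltr0n; case: n Nn.
rewrite lte_pdivrMl // -EFinM mulr_natl -lnXn // -[(lne _ < _)%E]lte_expeR lneK; last first.
  by rewrite in_itv /= leey max_separated_ge0.
by rewrite /= lnK // posrE exprn_gt0.
Qed.

End Entropy.

(** When the range of [phi] is cut into cells of length [e], two separated points never share a
    cell. *)
Lemma separated_size (R : realType) (a b e V : R) (f phi : R -> R) (n : nat) (s : seq R) :
  0 < e -> 0 <= V ->
  (forall x y, a <= x -> x <= y -> y <= b -> 0 <= phi y - phi x /\
     forall k, (k < n)%N -> `|iter k f x - iter k f y| <= phi y - phi x) ->
  phi b - phi a <= V -> dynamically_separated `[a, b] f n e s ->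
  (size s)%:R <= V / e + 1.
Proof.
move=> e0 V0 hphi hV [us sK sep].
pose g x := Num.truncn ((phi x - phi a) / e).
have sab x : x \in s -> a <= x <= b by move=> /sK; rewrite /= in_itv.
have pos x : x \in s -> 0 <= (phi x - phi a) / e.
  move=> /sab /andP[ax xb]; rewrite divr_ge0 ?(ltW e0) //.
  by have [] := hphi a x (lexx _) ax xb.
have lt x y : x \in s -> y \in s -> x < y -> (g x < g y)%N.
  move=> xs ys xy; have [k kn ek] := sep x y xs ys (negbT (lt_eqF xy)).
  have /andP[ax _] := sab _ xs; have /andP[_ yb] := sab _ ys.
  have [_ /(_ k kn) le1] := hphi x y ax (ltW xy) yb.
  rewrite truncn_gt_nat; have := truncn_itv (pos x xs) => /andP[h1 _].
  rewrite -natr1 (le_trans (y := (phi x - phi a) / e + 1)) ?lerD2r //.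
  rewrite -[X in _ + X <= _](divff (lt0r_neq0 e0)) -mulrDl ler_wpM2r ?invr_ge0 ?(ltW e0) //.
  lra.
have gi : {in s &, injective g}.
  move=> x y xs ys gxy; case: (ltgtP x y) => // /lt H.
    by move: (H xs ys); rewrite gxy ltnn.
  by move: (H ys xs); rewrite gxy ltnn.
have : (size (map g s) <= size (iota 0 (Num.truncn (V / e)).+1))%N.
  apply: uniq_leq_size; first by rewrite map_inj_in_uniq.
  move=> _ /mapP[x xs ->]; rewrite mem_iota /= add0n ltnS; apply: le_truncn.
  rewrite ler_wpM2r ?invr_ge0 ?(ltW e0) //; apply: le_trans hV.
  have /andP[ax xb] := sab _ xs.
  by have [] := hphi x b ax xb (lexx _); lra.
rewrite size_map size_iota => h; apply: (@le_trans _ _ (Num.truncn (V / e)).+1%:R).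
  by rewrite ler_nat.
rewrite -natr1 lerD2r truncn_le divr_ge0 // ltW //.
Qed.

Section FoldingVariation.
Variables (R : realType) (f : R -> R) (c : R) (inc : bool) (a b : R).
Hypothesis fold : folding f c inc a b.

Local Notation laps := (laps f c).
Local Notation between := (strictly_between c).

Lemma folding_lap u v : a <= u -> u < v -> v <= b -> ~~ between u v ->
  (forall x y, u <= x -> x < y -> y <= v -> f x < f y) \/
  (forall x y, u <= x -> x < y -> y <= v -> f y < f x).
Proof.
case: fold => _ _ hl hr au uv vb; rewrite /strictly_between negb_or => /andP[h _].
have [uc|cu] := ltP u c; last first.
  by case: inc hr {hl} => hr; [right|left] => x y ux xy yv;
    apply: hr; rewrite // ?(le_trans cu) ?(le_trans yv).
have vc : v <= c by move: h; rewrite uc /= -leNgt.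
by case: inc hl {hr} => hl; [left|right] => x y ux xy yv;
  apply: hl; rewrite // ?(le_trans au) ?(le_trans yv).
Qed.

Lemma betweenP u v : u < v -> between u v -> u < c < v.
Proof.
move=> uv /orP[//|/andP[vc cu]].
by have := lt_trans (lt_trans uv vc) cu; rewrite ltxx.
Qed.

(** A surrogate for total variation: a single [phi] controls the first [n] iterates at once, as
    [separated_size] requires. *)
Definition variation_le n u v V := exists phi : R -> R,
  (forall x y, u <= x -> x <= y -> y <= v -> 0 <= phi y - phi x /\
     forall k, (k < n)%N -> `|iter k f x - iter k f y| <= phi y - phi x) /\
  phi v - phi u <= V.

Lemma variation_le_split n u v w V W : u <= v -> v <= w ->
  variation_le n u v V -> variation_le n v w W -> variation_le n u w (V + W).
Proof.
move=> uv vw [p [hp pV]] [q [hq qW]].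
exists (fun x => if x <= v then p x else p v - q v + q x); split; last first.
  rewrite uv; case: ifP => wv; last lra.
  have -> : w = v by apply/le_anti; rewrite wv vw.
  have [] := hq v w (lexx _) vw (lexx _); lra.
move=> x y ux xy yw; case: (leP y v) => [yv|vy].
  by rewrite (le_trans xy yv); apply: hp.
case: (leP x v) => [xv|vx]; last first.
  have [h1 h2] := hq x y (ltW vx) xy yw; split; first lra.
  by move=> k /h2; lra.
have [p1 p2] := hp x v ux xv (lexx _); have [q1 q2] := hq v y (lexx _) (ltW vy) yw.
split; first lra.
move=> k kn; have := p2 k kn; have := q2 k kn.
have := ler_distD (iter k f v) (iter k f x) (iter k f y); lra.
Qed.

Lemma laps_ge1 n u v : 1 <= (laps n u v)%:R :> R.
Proof. by rewrite ler1n. Qed.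

(** Each lap contributes at most [b - a] for each of the [n] iterates. In the induction, [p] for the
    image yields [x + p (f x)] or [x - p (f x)] according to the sense of [f]; the term [x] accounts
    for time 0. *)
Lemma variation_laps n u v : a <= u -> u <= v -> v <= b ->
  variation_le n u v (n%:R * (laps n u v)%:R * (b - a)).
Proof.
elim: n u v => [|n IH] u v au uv vb.
  exists (fun=> 0); split; last by rewrite !mul0r subrr.
  by move=> *; split => //; rewrite subrr.
have lap w z : a <= w -> w <= z -> z <= b -> ~~ between w z ->
    variation_le n.+1 w z (n.+1%:R * (laps n (f w) (f z))%:R * (b - a)).
  move=> aw; rewrite le_eqVlt => /predU1P[<- wb _|wz zb nb].
    exists (fun x => x); split; last first.
      rewrite subrr !mulr_ge0 //; lra.
    move=> x y wx xy yw; have -> : x = y by apply/le_anti; rewrite xy (le_trans yw wx).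
    by split => [|k _]; rewrite !subrr ?normr0.
  have az := le_trans aw (ltW wz); have wb := le_trans (ltW wz) zb.
  have /andP[afw fwb] : a <= f w <= b by apply: (folding_map fold); rewrite aw wb.
  have /andP[afz fzb] : a <= f z <= b by apply: (folding_map fold); rewrite az zb.
  have L1 := laps_ge1 n (f w) (f z).
  have N0 : 0 <= n%:R :> R by [].
  have bound V : V <= n%:R * (laps n (f w) (f z))%:R * (b - a) ->
      z - w + V <= n.+1%:R * (laps n (f w) (f z))%:R * (b - a).
    by rewrite -natr1 => ?; nra.
  have [up|down] := folding_lap aw wz zb nb.
    have up' x y : w <= x -> x <= y -> y <= z -> f x <= f y.
      by move=> wx; rewrite le_eqVlt => /predU1P[->//|xy yz]; rewrite ltW // up.
    have [p [hp pV]] := IH (f w) (f z) afw (ltW (up _ _ (lexx _) wz (lexx _))) fzb.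
    exists (fun x => x + p (f x)); split; last first.
      by apply: le_trans (bound _ pV); lra.
    move=> x y wx xy yz.
    have [h1 h2] := hp _ _ (up' _ _ (lexx _) wx (le_trans xy yz)) (up' _ _ wx xy yz)
       (up' _ _ (le_trans wx xy) yz (lexx _)).
    split; first lra.
    case=> [|k] kn; first by rewrite /= distrC ger0_norm; lra.
    by have := h2 k kn; rewrite -!iterSr; lra.
  have up' x y : w <= x -> x <= y -> y <= z -> f y <= f x.
    by move=> wx; rewrite le_eqVlt => /predU1P[->//|xy yz]; rewrite ltW // down.
  have [p [hp pV]] := IH (f z) (f w) afz (ltW (down _ _ (lexx _) wz (lexx _))) fwb.
  exists (fun x => x - p (f x)); split; last first.
    by rewrite lapsC in pV; apply: le_trans (bound _ pV); lra.
  move=> x y wx xy yz.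
  have [h1 h2] := hp _ _ (up' _ _ (le_trans wx xy) yz (lexx _)) (up' _ _ wx xy yz)
     (up' _ _ (lexx _) wx (le_trans xy yz)).
  split; first lra.
  case=> [|k] kn; first by rewrite /= distrC ger0_norm; lra.
  by have := h2 k kn; rewrite -!iterSr distrC; lra.
rewrite lapsS; case: ifP => [bt|/negbT]; last exact: lap.
have {}uv : u < v.
  by rewrite lt_neqAle uv andbT; apply/eqP => E; move: bt;
     rewrite E /strictly_between orbb => /andP[/lt_trans h /h]; rewrite ltxx.
have /andP[uc cv] := betweenP uv bt; have /andP[ac cb] := folding_turn fold.
have nu : ~~ between u c by rewrite /strictly_between ltxx !andbF.
have nv : ~~ between c v by rewrite /strictly_between ltxx !andbF.
rewrite (natrD _ (laps n (f u) (f c))) [n.+1%:R * _]mulrDr mulrDl; apply: (variation_le_split (ltW uc) (ltW cv)).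
  exact: lap (ltW uc) cb nu.
exact: lap ac (ltW cv) vb nv.
Qed.

End FoldingVariation.

Lemma bernoulli_ineq (R : realDomainType) (t : R) n :
  0 <= t -> 1 + n%:R * t <= (1 + t) ^+ n.
Proof.
move=> t0; elim: n => [|n IH]; first by rewrite mul0r addr0 expr0.
rewrite exprS -natr1; apply: (@le_trans _ _ ((1 + t) * (1 + n%:R * t))).
  have : 0 <= n%:R * t * t by rewrite !mulr_ge0.
  by move=> ?; nra.
by rewrite ler_wpM2l // addr_ge0.
Qed.

(** * Submultiplicativity of lap numbers and the upper bound on entropy *)

Section FoldingLaps.
Variables (R : realType) (f : R -> R) (c : R) (inc : bool) (a b : R).
Hypothesis fold : folding f c inc a b.

Local Notation laps := (laps f c).
Local Notation between := (strictly_between c).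
Local Notation weakly_between u v w := ((u <= v <= w) || (w <= v <= u)).

Lemma weakly_between_folding u v w : a <= u <= b -> a <= w <= b ->
  ~~ between u w -> weakly_between u v w -> weakly_between (f u) (f v) (f w).
Proof.
wlog : u w / u <= w.
  move=> H; case/orP: (le_total u w) => uw hu hw nb wb; first exact: H.
  by rewrite orbC; apply: H; rewrite // 1?strictly_betweenC // orbC.
move=> uw /andP[au ub] /andP[aw wb] nb hb.
have {hb} /andP[uv vw] : u <= v <= w.
  by case/orP: hb => // /andP[wv vu]; rewrite (le_trans uw wv) (le_trans vu uw).
move: uw uv vw; rewrite le_eqVlt => /predU1P[<- uv vu|uw uv vw].
  have -> : v = u by apply/le_anti; rewrite vu uv.
  by rewrite lexx.
have [up|down] := folding_lap fold au uw wb nb.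
  apply/orP; left; apply/andP; split.
    by move: uv; rewrite le_eqVlt => /predU1P[->//|uv]; rewrite ltW ?up.
  by move: vw; rewrite le_eqVlt => /predU1P[->//|vw]; rewrite ltW ?up.
apply/orP; right; apply/andP; split.
  by move: vw; rewrite le_eqVlt => /predU1P[->//|vw]; rewrite ltW ?down.
by move: uv; rewrite le_eqVlt => /predU1P[->//|uv]; rewrite ltW ?down.
Qed.

Lemma laps_subinterval n u v w : a <= u <= b -> a <= v <= b -> a <= w <= b ->
  weakly_between u v w -> (laps n u v <= laps n u w)%N.
Proof.
elim: n u v w => [|n IH] u v w hu hv hw wb; first by rewrite !laps0.
have F := folding_map fold; have hc := folding_turn fold.
have step x y z : a <= x <= b -> a <= y <= b -> a <= z <= b ->
    ~~ between x z -> weakly_between x y z -> (laps n (f x) (f y) <= laps n (f x) (f z))%N.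
  move=> hx hy hz nb xyz; apply: IH; rewrite ?F //; exact: weakly_between_folding.
have nbt x : ~~ between c x by rewrite /strictly_between ltxx !andbF.
have nbt' x : ~~ between x c by rewrite strictly_betweenC.
rewrite !lapsS; case: ifPn => [uv|uv]; case: ifPn => [uw|uw].
- rewrite leq_add2l; apply: step => //.
  move: uv uw wb; rewrite /strictly_between; lra.
- exfalso; move: uv uw wb; rewrite /strictly_between; lra.
- apply: leq_trans (leq_addr _ _); apply: step => //.
  move: uv uw wb; rewrite /strictly_between; lra.
- exact: step.
Qed.

Lemma laps_max n u v : a <= u <= b -> a <= v <= b -> (laps n u v <= laps n a b)%N.
Proof.
move=> hu hv; have ha : a <= a <= b by rewrite lexx; case/andP: hu; exact: le_trans.
have hb : a <= b <= b by rewrite lexx; case/andP: hu => h1 h2; rewrite (le_trans h1 h2).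
wlog uv : u v hu hv / u <= v.
  by move=> H; case/orP: (le_total u v) => ?; [|rewrite lapsC]; apply: H.
apply: (@leq_trans (laps n u b)).
  by apply: laps_subinterval => //; case/andP: hv => _ ->; rewrite uv.
rewrite lapsC [in leqRHS]lapsC; apply: laps_subinterval => //.
by case/andP: hu => -> ->; rewrite orbT.
Qed.

(** The first [m] iterates map each of their laps monotonically into [[a, b]], where the next [n]
    iterates have at most [laps n a b] laps. *)
Lemma laps_submul m n u v : a <= u <= b -> a <= v <= b ->
  (laps (m + n) u v <= laps m u v * laps n a b)%N.
Proof.
elim: m u v => [|m IH] u v hu hv; first by rewrite laps0 mul1n laps_max.
have F := folding_map fold; have hc := folding_turn fold.
rewrite addSn !lapsS; case: ifP => _; last by rewrite IH ?F.
by rewrite mulnDl leq_add ?IH ?F.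
Qed.

Lemma laps_le_expr (r : R) m : 1 <= r -> (0 < m)%N -> (laps m a b)%:R <= r ^+ m ->
  exists C : R, 0 < C /\ forall n, (laps n a b)%:R <= C * r ^+ n.
Proof.
move=> r1 m0 hm; exists (laps m a b)%:R; split; first by rewrite ltr0n.
have r0 : 0 <= r by lra.
have [ha hb] : a <= a <= b /\ a <= b <= b.
  by case/andP: (folding_turn fold) => h1 h2; rewrite !lexx (le_trans h1 h2).
move=> n; rewrite {1}(divn_eq n m).
have pow q : (laps (q * m) a b)%:R <= r ^+ (q * m).
  elim: q => [|q IH]; first by rewrite laps0.
  rewrite mulSn exprD.
  apply: (@le_trans _ _ ((laps m a b)%:R * (laps (q * m) a b)%:R)).
    by rewrite -natrM ler_nat laps_submul.
  by apply: ler_pM.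
apply: (@le_trans _ _ ((laps (n %/ m * m) a b)%:R * (laps (n %% m) a b)%:R)).
  by rewrite -natrM ler_nat laps_submul.
rewrite mulrC ler_pM // ?ler_nat ?leq_laps ?(ltnW (ltn_pmod _ _)) //.
by apply: le_trans (pow _) _; rewrite ler_weXn2l // leq_divM.
Qed.

Lemma growth_rate_le_laps (r lam : R) m : 1 <= r -> (0 < m)%N ->
  (laps m a b)%:R <= r ^+ m -> growth_rate a b f = lam%:E -> lam <= r.
Proof.
move=> r1 m0 /(laps_le_expr r1 m0) [C [C0 hC]] gr; apply/ler_addgt0Pl => d d0.
pose q := d + r; pose t := d / r.
have [r0 q0] : 0 < r /\ 1 <= q by rewrite /q; split; lra.
have t0 : 0 < t by rewrite divr_gt0.
have qE : q = r * (1 + t) by rewrite /q /t; field; rewrite gt_eqF.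
clearbody t.
(* The bound of [variation_laps] carries a factor [n]; Bernoulli's inequality absorbs it by
   enlarging [r] to [q = r + d], with [d] arbitrarily small. *)
have lin n : n%:R * r ^+ n <= t^-1 * q ^+ n.
  have B := bernoulli_ineq n (ltW t0).
  rewrite qE exprMn mulrCA mulrC ler_wpM2l ?exprn_ge0 ?(ltW r0) //.
  by rewrite ler_pdivlMl // mulrC; apply: le_trans B; lra.
suff : (entropy `[a, b] f <= (ln q)%:E)%E.
  rewrite -lee_expeR; move: gr; rewrite /growth_rate => -> /=.
  by rewrite lnK ?lee_fin // posrE; lra.
case/andP: (folding_turn fold) => ac cb; have ab := le_trans ac cb.
apply: entropy_le_ln => // e e0; exists (t^-1 * C * (b - a) / e + 1) => n.
apply: ub_ereal_sup => _ [s hs <-]; rewrite lee_fin.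
have [phi [h1 h2]] := variation_laps fold n (lexx a) ab (lexx b).
have V0 : 0 <= n%:R * (laps n a b)%:R * (b - a) by rewrite mulr_ge0 // subr_ge0.
apply: le_trans (separated_size e0 V0 h1 h2 hs) _.
have q1 : 1 <= q ^+ n by rewrite exprn_ege1.
have -> : (t^-1 * C * (b - a) / e + 1) * q ^+ n =
    t^-1 * C * q ^+ n * ((b - a) / e) + q ^+ n by ring.
rewrite -(mulrA _ (b - a)) lerD // ler_wpM2r ?divr_ge0 ?subr_ge0 ?(ltW e0) //.
apply: (@le_trans _ _ (C * (n%:R * r ^+ n))).
  by rewrite mulrCA ler_wpM2l.
by rewrite mulrAC [X in _ <= X]mulrC ler_wpM2l // ltW.
Qed.

End FoldingLaps.

(** * Separated sets and itineraries *)

Lemma seq_gap (R : realType) (T : seq R) :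
  exists2 e : R, 0 < e & forall x y, x \in T -> y \in T -> `|x - y| < e -> x = y.
Proof.
elim: T => [|t T [e e0 he]]; first by exists 1.
have [d d0 hd] : exists2 d : R, 0 < d & forall y, y \in T -> `|t - y| < d -> t = y.
  elim: T {e e0 he} => [|u T [d d0 hd]]; first by exists 1.
  case: (eqVneq t u) => [<-|tu].
    exists d => // y /[!inE] /orP[/eqP ->//|]; exact: hd.
  exists (Num.min d `|t - u|); first by rewrite lt_min d0 normr_gt0 subr_eq0.
  move=> y /[!inE] /orP[/eqP -> |yT]; first by rewrite lt_min ltxx andbF.
  by rewrite lt_min => /andP[/(hd _ yT)].
exists (Num.min d e); first by rewrite lt_min d0.
move=> x y /[!inE] /orP[/eqP -> |xT] /orP[/eqP -> |yT] //; rewrite lt_min => /andP[h1 h2].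
- exact: hd.
- by apply/esym/hd; rewrite // distrC.
- exact: he.
Qed.

Section Itineraries.
Variables (R : realType) (f : R -> R) (c : R).

Fixpoint itinerary (n : nat) (x : R) : seq bool :=
  if n is n'.+1 then (x < c) :: itinerary n' (f x) else [::].

Lemma itinerary_add m n x :
  itinerary (m + n) x = itinerary m x ++ itinerary n (iter m f x).
Proof. by elim: m x => //= m IH x; rewrite IH -iterS iterSr. Qed.

(** Greedy choice: a point of [X] is kept only if no kept point shadows it for [n] steps. *)
Lemma separated_net (K : set R) n e (X : seq R) : 0 <= e -> (forall x, x \in X -> K x) ->
  exists2 s, dynamically_separated K f n e s & forall x, x \in X ->
    exists2 y, y \in s & forall k, (k < n)%N -> `|iter k f x - iter k f y| <= e.
Proof.
move=> e0; elim: X => [|x X IH] XK; first by exists [::] => //; split.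
have [|s [us sK sep] hs] := IH; first by move=> y yX; apply: XK; rewrite inE yX orbT.
have [[y ys hy]|no] := pselect (exists2 y, y \in s &
    forall k, (k < n)%N -> `|iter k f x - iter k f y| <= e).
  exists s; first by split.
  by move=> z /[!inE] /orP[/eqP -> |/hs//]; exists y.
have far y : y \in s -> exists2 k, (k < n)%N & e < `|iter k f x - iter k f y|.
  move=> ys; apply: contrapT => h; apply: no; exists y => // k kn.
  by rewrite leNgt; apply/negP => ek; apply: h; exists k.
have xs : x \notin s.
  by apply/negP => /far[k _]; rewrite subrr normr0 => /lt_geF; rewrite e0.
exists (x :: s).
  split; first by rewrite /= xs.
    by move=> z /[!inE] /orP[/eqP -> |/sK//]; apply: XK; rewrite inE eqxx.
  move=> y z /[!inE] /orP[/eqP -> |ys] /orP[/eqP -> |zs]; rewrite ?eqxx //.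
  - by move=> _; apply: far.
  - by move=> _; have [k kn ek] := far y ys; exists k; rewrite // distrC.
  - exact: sep.
move=> z /[!inE] /orP[/eqP -> |/hs[y ys hy]]; last by exists y; rewrite // inE ys orbT.
by exists x; [rewrite inE eqxx | move=> k _; rewrite subrr normr0].
Qed.

Section FoldingItineraries.
Variables (inc : bool) (a b : R).
Hypotheses (fold : folding f c inc a b) (cont : {within `[a, b], continuous f}).

Local Notation laps := (laps f c).
Local Notation between := (strictly_between c).

Lemma folding_IVT u v y : a <= u -> u <= v -> v <= b ->
  Num.min (f u) (f v) <= y <= Num.max (f u) (f v) -> exists2 x, u <= x <= v & f x = y.
Proof.
move=> au uv vb hy; have [|x] := IVT uv _ hy.
  apply: continuous_subspaceW cont => z /=; rewrite !in_itv /= => /andP[uz zv].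
  by rewrite (le_trans au uz) (le_trans zv vb).
by rewrite in_itv /= => h <-; exists x.
Qed.

(** One point is chosen inside each lap. Points for the image interval are pulled back through [f],
    and the two sides of [c] differ in the first symbol. *)
Lemma many_itineraries n u v : a <= u -> u < v -> v <= b ->
  exists s : seq R, [/\ size s = laps n u v, forall x, x \in s -> u < x < v &
    uniq (map (itinerary n) s)].
Proof.
elim: n u v => [|n IH] u v au uv vb.
  exists [:: (u + v) / 2]; rewrite laps0; split => // x /[!inE] /eqP ->; lra.
have step w z : a <= w -> w < z -> z <= b -> ~~ between w z ->
    exists s : seq R, [/\ size s = laps n (f w) (f z), forall x, x \in s -> w < x < z &
    uniq (map (itinerary n.+1) s)].
  move=> aw wz zb nb.
  have az := le_trans aw (ltW wz); have wb := le_trans (ltW wz) zb.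
  have /andP[afw fwb] : a <= f w <= b by apply: (folding_map fold); rewrite aw wb.
  have /andP[afz fzb] : a <= f z <= b by apply: (folding_map fold); rewrite az zb.
  have [s [sz sin us]] : exists s : seq R, [/\ size s = laps n (f w) (f z),
      forall x, x \in s -> Num.min (f w) (f z) < x < Num.max (f w) (f z) &
      uniq (map (itinerary n) s)].
    have [up|down] := folding_lap fold aw wz zb nb.
      have lt := up _ _ (lexx _) wz (lexx _).
      by have [s [h1 h2 h3]] := IH _ _ afw lt fzb; exists s; split => // x /h2;
        rewrite (min_l (ltW lt)) (max_r (ltW lt)).
    have lt := down _ _ (lexx _) wz (lexx _).
    have [s [h1 h2 h3]] := IH _ _ afz lt fwb; exists s; rewrite lapsC; split => // x /h2.
    by rewrite (min_r (ltW lt)) (max_l (ltW lt)).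
  have [g hg] : {g : R -> R & forall y,
      Num.min (f w) (f z) < y < Num.max (f w) (f z) -> w < g y < z /\ f (g y) = y}.
    apply: (@choice _ _ (fun y x => Num.min (f w) (f z) < y < Num.max (f w) (f z) ->
       w < x < z /\ f x = y)) => y.
    have [hy|] := boolP (_ < _ < _); last by exists y.
    have [|x /andP[wx xz] fx] := @folding_IVT w z y aw (ltW wz) zb.
      by case/andP: hy => /ltW -> /ltW ->.
    exists x => _; split => //; rewrite !lt_neqAle wx xz !andbT.
    move: hy; rewrite -fx lt_max gt_min; apply: contraPT.
    by rewrite negb_and !negbK => /orP[] /eqP E; rewrite E; lra.
  exists (map g s); rewrite size_map; split => //.
    by move=> _ /mapP[y /sin /hg[h _] ->].
  rewrite -map_comp; apply: (@map_uniq _ _ behead); rewrite -map_comp.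
  rewrite [X in uniq X](_ : _ = map (itinerary n) s) //.
  by apply/eq_in_map => y /sin /hg[_ /= ->].
rewrite lapsS; case: ifP => [bt|/negbT]; last exact: step.
have /andP[uc cv] := betweenP uv bt; have /andP[ac cb] := folding_turn fold.
have nu : ~~ between u c by rewrite /strictly_between ltxx !andbF.
have nv : ~~ between c v by rewrite /strictly_between ltxx !andbF.
have [s [s1 s2 s3]] := step _ _ au uc cb nu.
have [t [t1 t2 t3]] := step _ _ ac cv vb nv.
exists (s ++ t); rewrite size_cat s1 t1; split => //.
  move=> x; rewrite mem_cat => /orP[/s2|/t2] /andP[h1 h2].
    by rewrite h1 (lt_trans h2).
  by rewrite h2 (lt_trans uc).
rewrite map_cat cat_uniq s3 t3 andbT; apply/hasPn => _ /mapP[y yt ->].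
apply/negP => /mapP[x xs [/esym E _]]; move: E.
have /andP[_ ->] := s2 x xs; have /andP[cy _] := t2 y yt.
by rewrite ltNge (ltW cy).
Qed.

Lemma finite_preturning M : exists T : seq R, forall x k,
  a <= x <= b -> (k < M)%N -> iter k f x = c -> x \in T.
Proof.
elim: M => [|M [T hT]]; first by exists [::].
have [P hP] : exists P : seq R, forall x, a <= x <= b -> f x \in T -> x \in P.
  elim: T {hT} => [|t T [P hP]]; first by exists [::].
  have one u v : a <= u -> u < v -> v <= b -> ~~ between u v ->
      exists l, forall x, u <= x <= v -> f x = t -> x = l.
    move=> au uv vb nb.
    have [[l hl fl]|no] := pselect (exists2 l, u <= l <= v & f l = t); last first.
      by exists u => x hx fx; exfalso; apply: no; exists x.
    exists l => x /andP[ux xv] fx; case/andP: hl => ul lv.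
    have [up|down] := folding_lap fold au uv vb nb; case: (ltgtP x l) => // lt.
    - by have := up _ _ ux lt lv; rewrite fx fl ltxx.
    - by have := up _ _ ul lt xv; rewrite fx fl ltxx.
    - by have := down _ _ ux lt lv; rewrite fx fl ltxx.
    - by have := down _ _ ul lt xv; rewrite fx fl ltxx.
  have /andP[ac cb] : a < c < b by case: fold.
  have [|l hl] := one a c (lexx _) ac (ltW cb).
    by rewrite /strictly_between ltxx !andbF.
  have [|r hr] := one c b (ltW ac) cb (lexx _).
    by rewrite /strictly_between ltxx !andbF.
  exists [:: l, r & P] => x /andP[ax xb]; rewrite !inE => /orP[/eqP fx|/hP ->].
    by case: (leP x c) => xc; [rewrite (hl x) ?ax ?eqxx | rewrite (hr x) ?(ltW xc) ?eqxx ?orbT].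
  - by rewrite !orbT.
  - by rewrite ax.
exists (c :: P) => x [|k] hx kM; first by move=> /= ->; rewrite inE eqxx.
rewrite iterSr => E; rewrite inE hP ?orbT //; apply: hT E => //.
exact: (folding_map fold).
Qed.

(** By the intermediate value theorem, an iterate cannot change sides without some point between [x]
    and [y] being sent to [c]. *)
Lemma itinerary_constant n x y : a <= x -> x <= y -> y <= b ->
  (forall z k, x <= z <= y -> (k < n)%N -> iter k f z <> c) ->
  itinerary n x = itinerary n y.
Proof.
elim: n x y => // n IH x y ax xy yb h /=.
have F := folding_map fold.
congr (_ :: _).
  apply/idP/idP; last exact: le_lt_trans.
  move=> xc; rewrite ltNge; apply/negP => cy.
  by apply: (h c 0%N) => //; rewrite (ltW xc).
have /andP[afx fxb] : a <= f x <= b by rewrite F // ax (le_trans xy yb).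
have /andP[afy fyb] : a <= f y <= b by rewrite F // yb (le_trans ax xy).
have h' z k : Num.min (f x) (f y) <= z <= Num.max (f x) (f y) -> (k < n)%N ->
    iter k f z <> c.
  by move=> /(folding_IVT ax xy yb)[w hw <-] kn; rewrite -iterSr; apply: h.
case: (leP (f x) (f y)) => le.
  by apply: IH => // z k hz; apply: h'; rewrite (min_l le) (max_r le).
apply/esym/IH => //; first exact: ltW.
by move=> z k hz; apply: h'; rewrite (min_r (ltW le)) (max_l (ltW le)).
Qed.

(** A short interval contains at most one point [z] that meets [c] before time [M]; the three
    itineraries are those of [z] and of its two sides. *)
Lemma local_itineraries M : exists2 e : R, 0 < e & forall x, a <= x <= b ->
  exists2 B : seq (seq bool), (size B <= 3)%N &
    forall y, a <= y <= b -> `|y - x| <= e -> itinerary M y \in B.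
Proof.
have [T hT] := finite_preturning M; have [d d0 hd] := seq_gap T.
(* Two points within [d / 3] of [x] are at most [2 d / 3 < d] apart, so they cannot be distinct
   points of [T]. *)
exists (d / 3); first by rewrite divr_gt0.
move=> x hx; pose near y := a <= y <= b /\ `|y - x| <= d / 3.
have conv u v w : near u -> near v -> u <= w <= v -> near w.
  by rewrite /near !ler_norml => -[h1 h2] [h3 h4] h5; split; lra.
have sep u v : near u -> near v -> u \in T -> v \in T -> u = v.
  rewrite /near => -[_ h2] [_ h4] uT vT; apply: hd => //.
  have := ler_distD x u v; rewrite (distrC x v); lra.
have cst u v : near u -> near v -> u <= v ->
    (forall z, u <= z <= v -> z \in T -> False) -> itinerary M u = itinerary M v.
  move=> nu nv uv h; apply: itinerary_constant => //.
  - by case: nu => /andP[].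
  - by case: nv => /andP[].
  move=> z k hz kM E; have [hz' _] := conv _ _ _ nu nv hz.
  by apply: (h z hz); apply: hT hz' kM E.
have [[z nz zT]|no] := pselect (exists2 z, near z & z \in T); last first.
  exists [:: itinerary M x] => // y hy yx; rewrite inE.
  have nx : near x by split => //; rewrite subrr normr0 divr_ge0 ?ltW.
  have ny : near y by [].
  apply/eqP; case: (leP y x) => le; [|apply/esym]; apply: cst => //; try exact: ltW.
    by move=> z hz zT; apply: no; exists z => //; exact: conv hz.
  by move=> z hz zT; apply: no; exists z => //; exact: conv hz.
have side (P : R -> R -> Prop) : (forall u v w, P u z -> P v z -> u <= w <= v -> P w z) ->
    (~ P z z) -> exists w, forall y, near y -> P y z -> itinerary M y = w.
  move=> hP nP; have [[u nu Pu]|no] := pselect (exists2 u, near u & P u z); last first.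
    by exists [::] => y ny Py; exfalso; apply: no; exists y.
  exists (itinerary M u) => y ny Py.
  case: (leP y u) => le; [|apply/esym]; apply: cst => //; try exact: ltW.
    move=> t ht tT; apply: nP; rewrite -{1}(sep t z) //; last exact: conv ht.
    exact: hP ht.
  move=> t ht tT; apply: nP; rewrite -{1}(sep t z) //; last exact: conv ht.
  exact: hP ht.
have [|/negP|l hl] := side (fun u z => u < z).
- by move=> u v w h1 h2 /andP[_ wv]; exact: le_lt_trans h2.
- by rewrite ltxx.
have [|/negP|r hr] := side (fun u z => z < u).
- by move=> u v w h1 h2 /andP[uw _]; exact: lt_le_trans h1 _.
- by rewrite ltxx.
exists [:: itinerary M z; l; r] => // y hy yx; rewrite !inE.
case: (ltgtP y z) => [yz|zy|->]; last by rewrite eqxx.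
  by rewrite (hl y) ?eqxx ?orbT.
by rewrite (hr y) ?eqxx ?orbT.
Qed.

Lemma folding_iter k x : a <= x <= b -> a <= iter k f x <= b.
Proof. by move=> hx; elim: k => //= k; exact: (folding_map fold). Qed.

Lemma bowen_ball_itineraries M : (0 < M)%N -> exists2 e : R, 0 < e & forall q x,
  a <= x <= b -> exists2 B : seq (seq bool), (size B <= 3 ^ q)%N &
    forall y, a <= y <= b ->
      (forall k, (k < q * M)%N -> `|iter k f y - iter k f x| <= e) ->
      itinerary (q * M) y \in B.
Proof.
move=> M0; have [e e0 he] := local_itineraries M; exists e => //.
elim=> [|q IH] x hx; first by exists [:: [::]].
have [B sB hB] := he x hx; have [B' sB' hB'] := IH _ (folding_iter M hx).
exists [seq v ++ w | v <- B, w <- B']; first by rewrite size_allpairs expnS leq_mul.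
move=> y hy hk; rewrite mulSn itinerary_add; apply: allpairs_f.
  by apply: hB => //; apply: (hk 0%N); rewrite mulSn addn_gt0 M0.
apply: hB'; first exact: folding_iter.
by move=> k kq; rewrite -!iterD; apply: hk; rewrite mulSn addnC ltn_add2l.
Qed.

(** Every lap has its own itinerary, every itinerary occurs in a Bowen ball about a point of a
    maximal separated set, and each ball holds at most [3 ^ q] itineraries of length [q * M]. *)
Lemma laps_le_growth_rate (lam r : R) : growth_rate a b f = lam%:E -> 0 < lam -> lam < r ->
  exists2 m, (0 < m)%N & (laps m a b)%:R <= r ^+ m.
Proof.
move=> gr lam0 lr; pose p := (lam + r) / 2.
have p0 : 0 < p by rewrite /p; lra.
have [lp pr] : lam < p /\ p < r by rewrite /p; split; lra.
have hE : (entropy `[a, b] f < (ln p)%:E)%E.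
  by rewrite -lte_expeR; move: gr; rewrite /growth_rate => -> /=; rewrite lnK ?lte_fin ?posrE.
clearbody p.
(* The block length [M] is fixed before the scale [e], long enough for the gap between [p] and [r]
   to absorb the factor 3 of each block. *)
have [M M0 hM] : exists2 M, (0 < M)%N & 3 * p ^+ M <= r ^+ M.
  have t0 : 0 < r / p - 1 by rewrite subr_gt0 ltr_pdivlMr // mul1r.
  pose M := (Num.truncn (3 / (r / p - 1))).+1; exists M => //.
  have -> : r ^+ M = (1 + (r / p - 1)) ^+ M * p ^+ M.
    by rewrite -exprMn; congr (_ ^+ _); field; rewrite gt_eqF.
  rewrite ler_pM2r ?exprn_gt0 //; apply: le_trans (bernoulli_ineq M (ltW t0)).
  rewrite -[X in X <= _]add0r lerD // -ler_pdivrMr //; exact: ltW (truncnS_gt _).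
have [e e0 he] := bowen_ball_itineraries M0.
have [N hN] := lt_entropy e0 p0 hE.
exists (N.+1 * M)%N; first by rewrite muln_gt0.
set q := N.+1.
have /andP[ac cb] := folding_turn fold.
have ab : a < b by case: fold => /andP[h1 h2] _ _ _; exact: lt_trans h2.
have [X [sX Xab uX]] := many_itineraries (q * M) (lexx a) ab (lexx b).
have XK x : x \in X -> `[a, b]%classic x.
  by move=> /Xab; rewrite /= in_itv /= => /andP[/ltW -> /ltW ->].
have [s hs net] := separated_net (q * M) (ltW e0) XK.
have [B hB] : {B : R -> seq (seq bool) & forall x, a <= x <= b ->
    (size (B x) <= 3 ^ q)%N /\ forall y, a <= y <= b ->
      (forall k, (k < q * M)%N -> `|iter k f y - iter k f x| <= e) ->
      itinerary (q * M) y \in B x}.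
  apply: (@choice _ _ (fun x B => a <= x <= b -> (size B <= 3 ^ q)%N /\
    forall y, a <= y <= b ->
      (forall k, (k < q * M)%N -> `|iter k f y - iter k f x| <= e) ->
      itinerary (q * M) y \in B)) => x.
  have [hx|_] := boolP (a <= x <= b); last by exists [::].
  by have [B h1 h2] := he q x hx; exists B.
have sK x : x \in s -> a <= x <= b by case: hs => _ h _ /h; rewrite /= in_itv.
have le1 : (laps (q * M) a b <= size s * 3 ^ q)%N.
  rewrite -sX -(size_map (itinerary (q * M))).
  apply: (@leq_trans (size (flatten (map B s)))).
    apply: uniq_leq_size => // _ /mapP[x xX ->].
    have [y ys hy] := net x xX; apply/flattenP; exists (B y); first exact: map_f.
    by apply: (hB y (sK y ys)).2 => //; have := XK x xX; rewrite /= in_itv.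
  elim: (s) sK => [|y t IH] h //=; rewrite size_cat mulSn leq_add //.
    by apply: (hB y _).1; apply: h; rewrite inE eqxx.
  by apply: IH => z zt; apply: h; rewrite inE zt orbT.
have le2 : (size s)%:R < p ^+ (q * M).
  rewrite -lte_fin; apply: le_lt_trans (hN (q * M)%N _); last first.
    by rewrite /q; apply: leq_trans (leqnSn N) _; rewrite leq_pmulr.
  by apply: ereal_sup_ubound; exists s.
apply: (@le_trans _ _ ((size s)%:R * 3 ^+ q)).
  by rewrite -natrX -natrM ler_nat.
apply: (@le_trans _ _ (p ^+ (q * M) * 3 ^+ q)); first by rewrite ler_wpM2r // ltW.
rewrite mulnC exprM -exprMn [in leRHS]exprM mulrC.
by rewrite lerXn2r ?nnegrE ?exprn_ge0 ?mulr_ge0 ?exprn_ge0 //; lra.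
Qed.

End FoldingItineraries.
End Itineraries.

(** * The kneading polynomial *)

Lemma poly_norm_le_left (R : rcfType) (q : {poly R}) (t M : R) : 0 < t ->
  (forall x, 0 < x -> x < t -> `|q.[x]| <= M) -> `|q.[t]| <= M.
Proof.
move=> t0 h; rewrite leNgt; apply/negP => lt.
have e0 : 0 < `|q.[t]| - M by rewrite subr_gt0.
have [d d0 hd] := poly_cont t q e0.
pose x := Num.max (t / 2) (t - d / 2).
have [x0 xt xd] : [/\ 0 < x, x < t & `|x - t| < d].
  by rewrite /x; case: (leP (t / 2) (t - d / 2)) => ?; split; rewrite ?ltr_norml; lra.
have := hd x xd; have := h x x0 xt; rewrite distrC.
have := lerB_dist q.[t] q.[x]; lra.
Qed.

Lemma convolution_sum (R : comPzRingType) (g d : nat -> R) (t : R) N :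
  \sum_(m < N) (\sum_(k < m.+1) g k * d (m - k)%N) * t ^+ m =
  \sum_(k < N) g k * t ^+ k * \sum_(j < N - k) d j * t ^+ j.
Proof.
elim: N => [|N IH]; first by rewrite !big_ord0.
rewrite big_ord_recr /= IH [in RHS]big_ord_recr /= subSnn big_ord1.
rewrite [X in _ + X * _]big_ord_recr /= subnn mulrDl addrA expr0 mulr1.
rewrite [g N * _ * d 0%N]mulrAC; congr (_ + _).
rewrite big_distrl -big_split /=; apply: eq_bigr => k _.
rewrite subSn; last exact: ltnW (ltn_ord k).
rewrite big_ord_recr /= mulrDr; congr (_ + _).
have -> : t ^+ N = t ^+ k * t ^+ (N - k) by rewrite -exprD subnKC // ltnW.
ring.
Qed.

Lemma sum_expr_le (R : numFieldType) (t : R) N : 0 < t -> t < 1 ->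
  \sum_(m < N) t ^+ m <= (1 - t)^-1.
Proof.
move=> t0 t1; have d0 : 0 < 1 - t by rewrite subr_gt0.
rewrite -(ler_pM2l d0) divff ?gt_eqF //.
have -> : (1 - t) * \sum_(m < N) t ^+ m = 1 - t ^+ N.
  by rewrite -[RHS]opprB subrX1 -mulNr opprB.
by rewrite lerBlDr lerDl exprn_ge0 // ltW.
Qed.

(** * A renewal argument: the kneading polynomial vanishes at [1 / lam] *)

Section Renewal.
Variables (R : realType) (g : nat -> nat) (d : nat -> R) (p : nat) (lam : R).
Hypotheses (dp : forall j, d (p + j)%N = d j) (d1 : forall j, `|d j| <= 1) (p0 : (0 < p)%N).
Hypothesis conv : forall m, `|\sum_(k < m.+1) (g k)%:R * d (m - k)%N| <= 1.
Hypothesis lam1 : 1 < lam.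
Hypothesis upper : forall r, lam < r ->
  exists C : R, 0 < C /\ forall n, ((\sum_(k < n) g k).+1)%:R <= C * r ^+ n.
Hypothesis lower : forall n, lam ^+ n <= ((\sum_(k < n) g k).+1)%:R.

(** Splitting the sum over [p + L] indices after [p] or after [L] terms makes all cancel except one
    period of tail. *)
Lemma periodic_sum (t : R) L : 0 < t -> t < 1 ->
  `|(1 - t ^+ p) * (\sum_(j < L) d j * t ^+ j) - \sum_(j < p) d j * t ^+ j| <=
  p%:R * t ^+ L.
Proof.
move=> t0 t1.
have E : \sum_(j < p + L) d j * t ^+ j =
    \sum_(j < p) d j * t ^+ j + t ^+ p * \sum_(j < L) d j * t ^+ j.
  rewrite big_split_ord /=; congr (_ + _); rewrite big_distrr /=.
  by apply: eq_bigr => j _; rewrite dp exprD; ring.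
have E' : \sum_(j < L + p) d j * t ^+ j =
    \sum_(j < L) d j * t ^+ j + \sum_(j < p) d (L + j)%N * t ^+ (L + j).
  by rewrite big_split_ord.
rewrite addnC E in E'.
have -> : (1 - t ^+ p) * (\sum_(j < L) d j * t ^+ j) - \sum_(j < p) d j * t ^+ j
   = - \sum_(j < p) d (L + j)%N * t ^+ (L + j) by rewrite mulrBl mul1r; lra.
rewrite normrN; apply: le_trans (ler_norm_sum _ _ _) _.
apply: (@le_trans _ _ (\sum_(j < p) t ^+ L)); last first.
  by rewrite sumr_const card_ord mulr_natl.
apply: ler_sum => j _; rewrite normrM [`|t ^+ _|]ger0_norm ?exprn_ge0 ?(ltW t0) //.
apply: (@le_trans _ _ (t ^+ (L + j))).
  by rewrite ler_piMl // exprn_ge0 // ltW.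
by rewrite exprD ler_piMr ?exprn_ge0 ?(ltW t0) // exprn_ile1 // ltW.
Qed.

(** With [P] the sum of the [d j * t ^ j] over one period, the series of [d] is [P / (1 - t^p)], so
    [P] times the series of [g] is [1 - t^p] times a series with coefficients of modulus at most 1.
    The summand 1 pays for the truncation at [N']. *)
Lemma renewal_bound (t : R) N : 0 < t -> t * lam < 1 ->
  `|\sum_(j < p) d j * t ^+ j| * (\sum_(k < N) (g k)%:R * t ^+ k) <= 1 + (1 - t)^-1.
Proof.
move=> t0 tl.
have t1 : t < 1 by apply: lt_trans tl; rewrite ltr_pMr.
have [r lr rt] : exists2 r, lam < r & t * r < 1.
  exists ((lam + t^-1) / 2).
    have : lam < t^-1 by rewrite -[ltRHS]mul1r ltr_pdivlMr // mulrC.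
    lra.
  rewrite mulrA mulrDr divff ?gt_eqF //; lra.
have [C [C0 hC]] := upper lr.
have tr0 : 0 < t * r by rewrite mulr_gt0 // (lt_trans ltr01) // (lt_trans lam1).
have [N' NN' small] : exists2 N', (N <= N')%N & p%:R * C * (t * r) ^+ N' <= 1.
  pose D := p%:R * C.
  have s0 : 0 < (t * r)^-1 - 1 by rewrite subr_gt0 invf_gt1.
  pose K := (Num.truncn (D / ((t * r)^-1 - 1))).+1.
  exists (N + K)%N; first exact: leq_addr.
  have D0 : 0 <= D by rewrite mulr_ge0 // ltW.
  apply: (@le_trans _ _ (D * (t * r) ^+ K)).
    rewrite ler_wpM2l // addnC exprD ler_piMr ?exprn_ge0 ?exprn_ile1 // ltW //.
  rewrite -ler_pdivlMr ?exprn_gt0 // mul1r -exprVn.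
  have := bernoulli_ineq K (ltW s0); rewrite [1 + (_ - 1)]addrC subrK; apply: le_trans.
  rewrite -[X in X <= _]add0r lerD // -ler_pdivrMr //; exact: ltW (truncnS_gt _).
set P := \sum_(j < p) d j * t ^+ j.
pose G n := \sum_(k < n) (g k)%:R * t ^+ k.
have gt_ge0 k : 0 <= (g k)%:R * t ^+ k by rewrite mulr_ge0 // exprn_ge0 // ltW.
have GG : G N <= G N'.
  by rewrite /G -(subnKC NN') big_split_ord /= lerDl sumr_ge0.
apply: (@le_trans _ _ (`|P| * G N')); first by rewrite ler_wpM2l.
have G0 : 0 <= G N' by rewrite sumr_ge0.
rewrite -[G N']ger0_norm // -normrM.
pose S := \sum_(m < N') (\sum_(k < m.+1) (g k)%:R * d (m - k)%N) * t ^+ m.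
have S1 : `|S| <= (1 - t)^-1.
  apply: le_trans (sum_expr_le N' t0 t1); apply: le_trans (ler_norm_sum _ _ _) _.
  apply: ler_sum => m _; rewrite normrM [`|t ^+ _|]ger0_norm ?exprn_ge0 ?(ltW t0) //.
  by rewrite ler_piMl ?exprn_ge0 ?(ltW t0).
have E : P * G N' = (1 - t ^+ p) * S - \sum_(k < N') (g k)%:R * t ^+ k *
    ((1 - t ^+ p) * (\sum_(j < N' - k) d j * t ^+ j) - P).
  rewrite /S (convolution_sum (fun k => (g k)%:R)) [X in _ = X - _]mulr_sumr -sumrB /G mulr_sumr.
  by apply: eq_bigr => k _; ring.
have tp : 0 <= t ^+ p <= 1 by rewrite exprn_ge0 ?exprn_ile1 // ltW.
rewrite E; apply: le_trans (ler_normB _ _) _; rewrite addrC lerD //; last first.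
  rewrite normrM (le_trans _ S1) // ler_piMl // ger0_norm; lra.
apply: le_trans small; apply: le_trans (ler_norm_sum _ _ _) _.
apply: (@le_trans _ _ (\sum_(k < N') (g k)%:R * (p%:R * t ^+ N'))).
  apply: ler_sum => k _; rewrite normrM ger0_norm //.
  have -> : t ^+ N' = t ^+ k * t ^+ (N' - k) by rewrite -exprD subnKC // ltnW.
  by rewrite [p%:R * _]mulrCA [leRHS]mulrA ler_wpM2l // periodic_sum.
rewrite -mulr_suml -natr_sum exprMn mulrC -!mulrA ler_wpM2l //.
rewrite mulrCA ler_wpM2l ?exprn_ge0 ?(ltW t0) //.
by apply: le_trans (hC N'); rewrite ler_nat.
Qed.

(* The numbers [(\sum_(k < n) g k).+1 / lam ^+ n] are at least [1], so their
   sum diverges, whereas [renewal_bound] would make it converge if the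
   polynomial did not vanish at [1 / lam]. *)
Lemma renewal_root : \sum_(j < p) d j * lam^-1 ^+ j = 0.
Proof.
set t := lam^-1; have lam0 : 0 < lam by apply: lt_trans lam1.
have t0 : 0 < t by rewrite invr_gt0.
have t1 : t < 1 by rewrite invf_lt1.
have d0 : 0 < 1 - t by rewrite subr_gt0.
set P := \sum_(j < p) _.
have bound N : `|P| * (\sum_(k < N) (g k)%:R * t ^+ k) * (1 - t) <= 2.
  (* Multiplied by [1 - x], the bound of [renewal_bound] becomes [2 - x <= 2], uniform in [x], for a
     polynomial; continuity carries it to [1 / lam]. *)
  pose q := (\poly_(j < p) d j) * (\poly_(k < N) (g k)%:R) * (1 - 'X) : {poly R}.
  have qE x : q.[x] = (\sum_(j < p) d j * x ^+ j) * (\sum_(k < N) (g k)%:R * x ^+ k) * (1 - x).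
    by rewrite /q !hornerE !horner_poly.
  have nE x : 0 < x -> x < 1 -> `|q.[x]| = `|\sum_(j < p) d j * x ^+ j| *
     (\sum_(k < N) (g k)%:R * x ^+ k) * (1 - x).
    move=> x0 x1; rewrite qE !normrM [`|1 - x|]ger0_norm ?subr_ge0 ?(ltW x1) //.
    rewrite [X in _ * X * _]ger0_norm // sumr_ge0 // => k _.
    by rewrite mulr_ge0 // exprn_ge0 // ltW.
  rewrite -nE //; apply: poly_norm_le_left => // x x0 xt.
  have x1 := lt_trans xt t1; rewrite nE //.
  apply: (@le_trans _ _ ((1 + (1 - x)^-1) * (1 - x))).
    rewrite ler_wpM2r ?subr_ge0 ?(ltW x1) // renewal_bound //.
    by rewrite -ltr_pdivlMr // mul1r.
  rewrite mulrDl mulVf ?gt_eqF ?subr_gt0 //; lra.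
apply/eqP; apply: contraT => Pn0.
have P0 : 0 < `|P| by rewrite normr_gt0.
pose B := 2 / (`|P| * (1 - t)).
have hB N : \sum_(k < N) (g k)%:R * t ^+ k <= B.
  rewrite /B ler_pdivlMr ?mulr_gt0 //; apply: le_trans (bound N); lra.
have key N : N%:R <= (1 + B) / (1 - t).
  pose A n : R := \sum_(k < n) (g k)%:R.
  have -> : N%:R = \sum_(n < N) (1 : R) by rewrite sumr_const card_ord.
  apply: (@le_trans _ _ (\sum_(n < N) (t ^+ n + A n * t ^+ n))).
    apply: ler_sum => n _; have := ler_wpM2r (ltW (exprn_gt0 n t0)) (lower n).
    rewrite -exprMn mulfV ?gt_eqF // expr1n -[X in _ <= X * _]natr1 natr_sum.
    by rewrite mulrDl mul1r addrC.
  rewrite big_split /= mulrDl mul1r lerD ?sum_expr_le // ler_pdivlMr //.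
  (* Abel summation turns the sum of the [A n * t ^ n] into the bounded sum of the [g k * t ^ k]. *)
  have E : \sum_(n < N) A n * t ^+ n * (1 - t) + A N * t ^+ N =
      t * \sum_(k < N) (g k)%:R * t ^+ k.
    elim: N => [|N IH]; first by rewrite /A !big_ord0 mul0r mulr0 addr0.
    rewrite big_ord_recr /= [A N.+1]big_ord_recr /= -/(A N) [in RHS]big_ord_recr /= [in RHS]mulrDr -IH exprS.
    ring.
  rewrite mulr_suml; apply: le_trans (hB N).
  have G0 : 0 <= \sum_(k < N) (g k)%:R * t ^+ k.
    by apply: sumr_ge0 => k _; rewrite mulr_ge0 // exprn_ge0 // ltW.
  apply: (@le_trans _ _ (t * \sum_(k < N) (g k)%:R * t ^+ k)); last by rewrite ler_piMl // ltW.
  by rewrite -E lerDl mulr_ge0 ?sumr_ge0 ?exprn_ge0 // ltW.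
have := truncnS_gt ((1 + B) / (1 - t)); have := key (Num.truncn ((1 + B) / (1 - t))).+1.
by move=> h1 h2; have := le_lt_trans h1 h2; rewrite ltxx.
Qed.

End Renewal.

Lemma critically_periodic_root (R : realType) (f : R -> R) (c : R) (inc : bool)
    (a b lam : R) (p : nat) :
  folding f c inc a b -> {within `[a, b], continuous f} ->
  growth_rate a b f = lam%:E -> 1 < lam -> (0 < p)%N -> iter p f c = c ->
  \sum_(j < p) theta f c inc j c false * lam^-1 ^+ j = 0.
Proof.
move=> fold cont gr lam1 p0 pc.
have th1 j : `|theta f c inc j c false| = 1.
  by case: (theta_pm1 f c inc j c false) => ->; rewrite ?normrN normr1.
apply: (@renewal_root R (fun k => turns f c k a b) (fun j => theta f c inc j c false) p lam) => //.
- by move=> j; rewrite theta_periodic.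
- by move=> j; rewrite th1.
- exact: kneading_bound fold.
- move=> r lr; have [m m0 hm] := laps_le_growth_rate fold cont gr (lt_trans ltr01 lam1) lr.
  by apply: (laps_le_expr fold _ m0 hm); rewrite ltW // (lt_trans lam1).
case=> [|m]; first by rewrite big_ord0 expr0.
(* If a lap number were below [lam ^ m.+1], it would be at most [r ^ m.+1] for some [r < lam], and
   submultiplicativity would bound the growth rate by [r]. *)
rewrite leNgt; apply/negP => lt.
have e0 : 0 < lam ^+ m.+1 - (laps f c m.+1 a b)%:R by rewrite subr_gt0.
have [d d0 hd] := poly_cont lam 'X^(m.+1) e0.
pose r := Num.max 1 (lam - d / 2).
have [r1 rl rd] : [/\ 1 <= r, r < lam & `|r - lam| < d].
  by rewrite /r; case: (leP 1 (lam - d / 2)) => ?; split; rewrite ?ltr_norml; lra.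
have := hd r rd; rewrite !hornerXn ltr_norml => /andP[h _].
have : lam <= r by apply: (growth_rate_le_laps fold r1 (ltn0Sn m)) gr; lra.
by rewrite leNgt rl.
Qed.

Lemma unimodal_folding (R : realType) (a b c : R) (f : R -> R) :
  unimodal a b f c -> exists inc, folding f c inc a b.
Proof.
case=> acb _ map mono.
have hm x : a <= x <= b -> a <= f x <= b by have := map x; rewrite !in_itv.
case: mono => -[hl hr]; [exists true | exists false]; split => //= x y h1 xy h2;
  have h3 := le_trans h1 (ltW xy); have h4 := le_trans (ltW xy) h2;
  first [by apply: hl; rewrite // in_itv /= ?h1 ?h2 ?h3 ?h4
       | by apply: hr; rewrite // in_itv /= ?h1 ?h2 ?h3 ?h4].
Qed.

Lemma minimal_polynomial_dvd (F : numFieldType) (x : F) (p q : {poly rat}) :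
  minimal_polynomial x p -> root (map_poly ratr q) x -> p %| q.
Proof.
case=> mon rp minp rq; rewrite /dvdp; apply: contraT => r0.
have p0 : p != 0 by rewrite monic_neq0.
have : (size p <= size (q %% p)%R)%N.
  apply: minp => //; move: rq; rewrite {1}(Pdiv.Field.divp_eq q p) rmorphD rmorphM /=.
  by rewrite rootE !hornerE (eqP rp) mulr0 add0r.
by rewrite leqNgt ltn_modp p0.
Qed.

Lemma minimal_polynomial_irreducible (F : numFieldType) (x : F) (p : {poly rat}) :
  p \is monic -> irreducible_poly p -> root (map_poly ratr p) x ->
  minimal_polynomial x p.
Proof.
move=> mon [p1 irr] rp; split => // q q0 rq; apply: dvdp_leq => //.
have rg : root (map_poly ratr (gcdp p q)) x by rewrite gcdp_map root_gcd rp rq.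
have /irr/(_ (dvdp_gcdl _ _)) E : size (gcdp p q) != 1%N.
  apply/eqP => /eqP /size_poly1P [u u0 E]; move: rg.
  by rewrite E map_polyC rootC fmorph_eq0 (negbTE u0).
by rewrite -(eqp_dvdl _ E) dvdp_gcdr.
Qed.

(** Multiplication by [lam ^ p.-1] reverses the coefficients; the reversed polynomial is rational
    and vanishes at [lam], so the minimal polynomial divides it. *)
Lemma signed_sum_of_pm1 (R : realType) (p : nat) (d : nat -> R) (lam : R) (z : R[i]) :
  (forall j, d j = 1 \/ d j = -1) -> lam != 0 ->
  \sum_(j < p) d j * lam^-1 ^+ j = 0 -> galois_conjugate lam z ->
  exists s : nat -> bool, \sum_(i < p) (-1) ^+ (s i) * z ^+ i = 0.
Proof.
move=> d1 lam0 S0 [m hm rz].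
pose s i := d (p - i.+1)%N == -1.
exists s.
pose q : {poly rat} := \poly_(i < p) (-1) ^+ s i.
have qE (F : numFieldType) (x : F) :
    (map_poly ratr q).[x] = \sum_(i < p) (-1) ^+ s i * x ^+ i.
  rewrite (@horner_coef_wide _ p); last by rewrite size_map_poly size_poly.
  by apply: eq_bigr => i _; rewrite coef_map coef_poly ltn_ord /= rmorphXn rmorphN rmorph1.
rewrite -qE; have /dvdpP[r ->] : m %| q; last first.
  by rewrite rmorphM hornerE (eqP rz) mulr0.
apply: minimal_polynomial_dvd hm _; rewrite rootE qE; apply/eqP.
have -> : \sum_(i < p) (-1) ^+ s i * lam ^+ i =
    lam ^+ p.-1 * \sum_(j < p) d j * lam^-1 ^+ j.
  rewrite mulr_sumr (reindex_inj rev_ord_inj) /=; apply: eq_bigr => j _.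
  have jp := ltn_ord j; rewrite mulrCA; congr (_ * _).
    rewrite /s subnSK // subKn; last exact: ltnW.
    have n1 : (1 == -1 :> R) = false by apply/negbTE/eqP => h; lra.
    by case: (d1 j) => ->; rewrite ?eqxx ?n1.
  rewrite exprVn; have -> : p.-1 = (p - j.+1 + j)%N by rewrite -{1}(subnK jp) addnS.
  by rewrite exprD mulfK // expf_neq0.
by rewrite S0 mulr0.
Qed.

Lemma conjugates_cp_signed_sum (R : realType) (z : R[i]) : conjugates_cp R z ->
  exists p, exists2 s : nat -> bool, (0 < p)%N & \sum_(i < p) (-1) ^+ (s i) * z ^+ i = 0.
Proof.
case=> a [b [f [c [lam [uni [p p0 pc] gr conj]]]]].
have [inc fold] := unimodal_folding uni; have [_ cont _ _] := uni.
have lam1 : 1 <= lam.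
  have ab : a <= b by case/andP: (folding_turn fold); exact: le_trans.
  rewrite -lee_fin -gr -expeR0 lee_expeR; apply: entropy_ge0.
  by exists a; rewrite /= in_itv /= lexx.
have lam0 : lam != 0 by rewrite gt_eqF // (lt_le_trans ltr01).
move: lam1; rewrite le_eqVlt => /predU1P[lamE|lam1].
  (* Growth rate 1 escapes the renewal argument, but 1 is a root of [1 - X]. *)
  have [|||s S0] := @signed_sum_of_pm1 R 2 (fun j => if j is 0 then 1 else -1) lam z _ _ _ conj => //.
  - by case=> [|j]; [left|right].
  - by rewrite !big_ord_recl big_ord0 /= -lamE invr1 !expr1n; ring.
  by exists 2%N, s.
have S0 := critically_periodic_root fold cont gr lam1 p0 pc.
have [s hs] := signed_sum_of_pm1 (fun j => theta_pm1 f c inc j c false) lam0 S0 conj.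
by exists p, s.
Qed.

(** * Tent maps *)

Section Tent.
Variables (R : realType) (s : R).
Hypotheses (s1 : 1 < s) (s2 : s <= 2).

Definition tent (x : R) : R := 1 - s * `|x|.

Lemma tent_unimodal : unimodal (1 - s) 1 tent 0.
Proof.
move: (s1) (s2) => gt1 le2; have s0 := lt_trans ltr01 gt1.
split.
- by apply/andP; split; rewrite ?ltr01 // subr_lt0.
- apply: continuous_subspaceT => x; apply: cvgB; first exact: cvg_cst.
  by apply: cvgM; [exact: cvg_cst | exact: norm_continuous].
- move=> x; rewrite !in_itv /= => /andP[h1 h2]; rewrite /tent.
  have x1 : `|x| <= 1 by rewrite ler_norml; apply/andP; split; lra.
  have x0 : 0 <= `|x| by [].
  by apply/andP; split; nra.
left; split=> x y; rewrite !in_itv /= => /andP[h1 h2] /andP[h3 h4] xy; rewrite /tent.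
  by rewrite !ler0_norm //; nra.
by rewrite !ger0_norm //; nra.
Qed.

Lemma tent_lipschitz k x y : `|iter k tent x - iter k tent y| <= s ^+ k * `|x - y|.
Proof.
have s0 : 0 <= s by apply: ltW; apply: lt_trans s1.
elim: k => [|k IH]; first by rewrite expr0 mul1r.
rewrite /= exprS -mulrA; apply: le_trans (ler_wpM2l s0 IH).
have -> : tent (iter k tent x) - tent (iter k tent y) =
   s * (`|iter k tent y| - `|iter k tent x|) by rewrite /tent; ring.
by rewrite normrM ger0_norm // ler_wpM2l // distrC ler_dist_dist.
Qed.

(** The [n]-th iterate stretches each lap by exactly [s ^ n], into an interval of length [s]. *)
Lemma tent_laps n u v : 1 - s <= u -> u <= 1 -> 1 - s <= v -> v <= 1 ->
  s ^+ n * `|u - v| <= (laps tent 0 n u v)%:R * s.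
Proof.
move: (s1) (s2) => gt1 le2; have s0 := ltW (lt_trans ltr01 gt1).
elim: n u v => [|n IH] u v u1 u2 v1 v2.
  by rewrite laps0 expr0 !mul1r ler_norml; apply/andP; split; lra.
have map x : 1 - s <= x -> x <= 1 -> 1 - s <= tent x /\ tent x <= 1.
  move=> h1 h2; have [_ _ /(_ x) + _] := tent_unimodal.
  by rewrite !in_itv /= h1 h2 => /(_ isT) /andP[].
have step x y : 1 - s <= x -> x <= 1 -> 1 - s <= y -> y <= 1 ->
    ~~ strictly_between 0 x y ->
    s ^+ n.+1 * `|x - y| <= (laps tent 0 n (tent x) (tent y))%:R * s.
  move=> x1 x2 y1 y2 nb; have [a1 a2] := map x x1 x2; have [b1 b2] := map y y1 y2.
  have := IH _ _ a1 a2 b1 b2; suff -> : `|tent x - tent y| = s * `|x - y|.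
    by rewrite mulrA -exprSr.
  have -> : tent x - tent y = s * (`|y| - `|x|) by rewrite /tent; ring.
  rewrite normrM ger0_norm //; congr (_ * _).
  move: nb; rewrite /strictly_between negb_or !negb_and -!leNgt => /andP[].
  case: (leP 0 x) => hx; case: (leP 0 y) => hy //=; rewrite ?orbF.
  - by move=> _ _; rewrite (ger0_norm hx) (ger0_norm hy) distrC.
  - move=> _ x0; have -> : x = 0 by apply/le_anti; rewrite hx x0.
    by rewrite normr0 subr0 sub0r normr_id normrN.
  - move=> y0 _; have -> : y = 0 by apply/le_anti; rewrite hy y0.
    by rewrite normr0 subr0 sub0r normrN normr_id.
  - by move=> _ _; rewrite (ltr0_norm hx) (ltr0_norm hy) opprK addrC.
rewrite lapsS; case: ifPn => [bt|]; last exact: step.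
have z1 : 1 - s <= 0 by rewrite subr_le0 ltW.
have n1 : ~~ strictly_between 0 u 0 by rewrite /strictly_between ltxx !andbF.
have n2 : ~~ strictly_between 0 0 v by rewrite /strictly_between ltxx !andbF.
have E1 := step _ _ u1 u2 z1 ler01 n1; have E2 := step _ _ z1 ler01 v1 v2 n2.
rewrite natrD mulrDl; apply: le_trans (lerD E1 E2); rewrite -mulrDr.
by rewrite ler_wpM2l ?exprn_ge0 // ler_distD.
Qed.

(** The Lipschitz constants give the upper bound, with [s ^ n * x] as variation function; a smaller
    growth rate would contradict the lap count of [tent_laps]. *)
Lemma tent_growth_rate : growth_rate (1 - s) 1 tent = s%:E.
Proof.
move: (s1) (s2) => gt1 le2; have s0 := lt_trans ltr01 gt1.
have [inc fold] := unimodal_folding tent_unimodal.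
have le1 : (entropy `[(1 - s)%R, 1%R] tent <= (ln s)%:E)%E.
  apply: entropy_le_ln; first exact: ltW.
  move=> e e0; exists (s / e + 1) => n; apply: ub_ereal_sup => _ [t ht <-].
  rewrite lee_fin.
  have h x y : 1 - s <= x -> x <= y -> y <= 1 -> 0 <= s ^+ n * y - s ^+ n * x /\
     forall k, (k < n)%N -> `|iter k tent x - iter k tent y| <= s ^+ n * y - s ^+ n * x.
    move=> _ xy _; rewrite -mulrBr; split; first by rewrite mulr_ge0 ?exprn_ge0 ?subr_ge0 // ltW.
    move=> k kn; apply: le_trans (tent_lipschitz k x y) _.
    rewrite distrC ger0_norm ?subr_ge0 // ler_wpM2r ?subr_ge0 //.
    by rewrite ler_weXn2l ?(ltW gt1) ?(ltnW kn).
  have V0 : 0 <= s ^+ n * s by rewrite mulr_ge0 ?exprn_ge0 // ltW.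
  have hV : s ^+ n * 1 - s ^+ n * (1 - s) <= s ^+ n * s by rewrite -mulrBr opprB addrC subrK.
  apply: le_trans (separated_size e0 V0 h hV ht) _.
  by rewrite mulrDl mul1r -mulrA mulrC lerD ?exprn_ege1 ?(ltW s1).
have ge0 : (0 <= entropy `[(1 - s)%R, 1%R] tent)%E.
  by apply: entropy_ge0; exists 0; rewrite /= in_itv /= ler01 subr_le0 ltW.
have [ent hE] : exists ent, entropy `[(1 - s)%R, 1%R] tent = ent%:E.
  exists (fine (entropy `[(1 - s)%R, 1%R] tent)); rewrite fineK ?ge0_fin_numE //.
  exact: le_lt_trans le1 (ltry _).
have gr : growth_rate (1 - s) 1 tent = (expR ent)%:E by rewrite /growth_rate hE.
rewrite gr; congr (_%:E); apply/le_anti/andP; split.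
  by rewrite hE lee_fin in le1; rewrite -[leRHS]lnK ?ler_expR.
rewrite leNgt; apply/negP => lt.
pose r := (expR ent + s) / 2.
have [hr rs] : expR ent < r /\ r < s by rewrite /r; split; lra.
have [_ cont _ _] := tent_unimodal.
have [m m0 hm] := laps_le_growth_rate fold cont gr (expR_gt0 ent) hr.
have a1 : 1 - s <= 1 by lra.
have := tent_laps m (lexx _) a1 a1 (lexx _).
have -> : `|1 - s - 1| = s by rewrite addrAC subrr sub0r normrN gtr0_norm.
rewrite ler_pM2r // => /le_trans/(_ hm).
have r0 : 0 <= r by apply/ltW/(lt_trans _ hr)/expR_gt0.
by rewrite ler_pXn2r ?nnegrE ?(ltW s0) // leNgt rs.
Qed.

End Tent.

(** * Signed power series near a Gaussian rational *)

Section SignedSums.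
Variables (C : numFieldType) (r : C).
Hypotheses (r0 : 0 < r) (r1 : r < 1).

Lemma geometric_tail (e : nat -> C) (z : C) k m : (forall i, `|e i| <= 1) -> `|z| <= r ->
  `|\sum_(i < m) e (k + i)%N * z ^+ (k + i)| <= r ^+ k / (1 - r).
Proof.
move=> e1 zr; apply: le_trans (ler_norm_sum _ _ _) _.
apply: (@le_trans _ _ (\sum_(i < m) r ^+ k * r ^+ i)).
  apply: ler_sum => i _; rewrite -exprD normrM normrX.
  apply: le_trans (ler_wpM2r _ (e1 _)) _; first by rewrite exprn_ge0.
  by rewrite mul1r lerXn2r ?nnegrE // ltW.
by rewrite -mulr_sumr ler_wpM2l ?exprn_ge0 ?(ltW r0) // sum_expr_le.
Qed.

(** Periodicity makes the sums of [m * n] terms vanish for all [m], so a partial sum is the opposite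
    of a tail. *)
Lemma vanishing_partial_sum (e : nat -> C) (z : C) n k : (0 < n)%N ->
  (forall i, `|e i| <= 1) -> (forall i, e (n + i)%N = e i) -> `|z| <= r ->
  \sum_(i < n) e i * z ^+ i = 0 -> `|\sum_(i < k) e i * z ^+ i| <= r ^+ k / (1 - r).
Proof.
move=> n0 e1 en zr S0.
have Sm m : \sum_(i < m * n) e i * z ^+ i = 0.
  elim: m => [|m IH]; first by rewrite big_ord0.
  rewrite mulSn big_split_ord /= S0 add0r.
  rewrite (eq_bigr (fun i : 'I_(m * n) => z ^+ n * (e i * z ^+ i))).
    by rewrite -mulr_sumr IH mulr0.
  by move=> i _; rewrite en exprD mulrCA.
have := Sm k; rewrite -(subnKC (leq_pmulr k n0)) big_split_ord /= => /eqP.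
by rewrite addr_eq0 => /eqP ->; rewrite normrN geometric_tail.
Qed.

(** The bound is the fixed point of [B = r * B + eta / (1 - r)], the recursion obtained by factoring
    one power out of each term. *)
Lemma sum_expr_dist (z w eta : C) k : `|z| <= r -> `|w| <= r -> `|z - w| <= eta ->
  \sum_(i < k) `|z ^+ i - w ^+ i| <= eta / (1 - r) ^+ 2.
Proof.
move=> zr wr zw; have d0 : 0 < 1 - r by rewrite subr_gt0.
have eta0 : 0 <= eta by apply: le_trans zw.
elim: k => [|k IH]; first by rewrite big_ord0 mulr_ge0 // invr_ge0 exprn_ge0 // ltW.
rewrite big_ord_recl !expr0 subrr normr0 add0r.
apply: (@le_trans _ _ (\sum_(i < k) (r * `|z ^+ i - w ^+ i| + eta * r ^+ i))).
  apply: ler_sum => i _; rewrite /= /bump /= add1n.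
  have -> : z ^+ i.+1 - w ^+ i.+1 = z * (z ^+ i - w ^+ i) + (z - w) * w ^+ i.
    by rewrite !exprS; ring.
  apply: le_trans (ler_normD _ _) _; rewrite !normrM normrX lerD ?ler_wpM2r //.
  by apply: ler_pM; rewrite ?exprn_ge0 // lerXn2r ?nnegrE // ltW.
rewrite big_split -!mulr_sumr /=.
apply: (@le_trans _ _ (r * (eta / (1 - r) ^+ 2) + eta * (1 - r)^-1)).
  by rewrite lerD // ler_wpM2l ?(ltW r0) // sum_expr_le.
rewrite le_eqVlt; apply/orP; left; apply/eqP; field.
by rewrite gt_eqF.
Qed.

Lemma signed_sum_near (e : nat -> C) (z w eta : C) n k : (0 < n)%N ->
  (forall i, `|e i| <= 1) -> (forall i, e (n + i)%N = e i) ->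
  `|z| <= r -> `|w| <= r -> `|z - w| <= eta ->
  \sum_(i < n) e i * z ^+ i = 0 ->
  `|\sum_(i < k) e i * w ^+ i| <= r ^+ k / (1 - r) + eta / (1 - r) ^+ 2.
Proof.
move=> n0 e1 en zr wr zw S0.
have -> : \sum_(i < k) e i * w ^+ i =
    \sum_(i < k) e i * z ^+ i - \sum_(i < k) e i * (z ^+ i - w ^+ i).
  by rewrite -sumrB; apply: eq_bigr => i _; ring.
apply: le_trans (ler_normB _ _) _; rewrite lerD ?(vanishing_partial_sum k n0) //.
apply: le_trans (sum_expr_dist k zr wr zw); apply: le_trans (ler_norm_sum _ _ _) _.
by apply: ler_sum => i _; rewrite normrM ler_piMl.
Qed.

End SignedSums.

Section GaussianIntegers.
Variable C : numClosedFieldType.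

Definition ofZ (x : Z) : C := (int_of_Z x)%:~R.

Lemma ofZD x y : ofZ (x + y)%BZ = ofZ x + ofZ y.
Proof. by rewrite /ofZ -intrD; congr (_%:~R); lia. Qed.
Lemma ofZM x y : ofZ (x * y)%BZ = ofZ x * ofZ y.
Proof. by rewrite /ofZ -intrM; congr (_%:~R); lia. Qed.
Lemma ofZB x y : ofZ (x - y)%BZ = ofZ x - ofZ y.
Proof. by rewrite /ofZ -intrB; congr (_%:~R); lia. Qed.
Lemma ltr_ofZ x y : (ofZ x < ofZ y) = (x <? y)%BZ.
Proof. by rewrite /ofZ ltr_int; lia. Qed.
Lemma ler_ofZ x y : (ofZ x <= ofZ y) = (x <=? y)%BZ.
Proof. by rewrite /ofZ ler_int; lia. Qed.
Lemma ofZ_real x : ofZ x \is Num.real.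
Proof. exact: realz. Qed.

Definition gaussian (u : Z * Z) : C := ofZ u.1 + 'i * ofZ u.2.
Definition gauss_mul (u v : Z * Z) : Z * Z :=
  (u.1 * v.1 - u.2 * v.2, u.1 * v.2 + u.2 * v.1)%BZ.
Definition gauss_norm2 (u : Z * Z) : Z := (u.1 * u.1 + u.2 * u.2)%BZ.

Lemma gaussianM u v : gaussian (gauss_mul u v) = gaussian u * gaussian v.
Proof.
rewrite /gaussian /= ofZB ofZD !ofZM.
have i2 : 'i * 'i = -1 :> C by rewrite -expr2 sqrCi.
rewrite !(mulrDl, mulrDr) (mulrACA _ _ 'i) i2; ring.
Qed.

Lemma normr_gaussian u : `|gaussian u| ^+ 2 = ofZ (gauss_norm2 u).
Proof. by rewrite normC2_rect ?ofZ_real // ofZD !ofZM !expr2. Qed.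

Variables (D rho h : Z) (w : Z * Z).

(* With [u = D ^ k * S_k] for the partial sum [S_k] of a series at [w / D],
   [wk = w ^ k], [rk = rho ^ k], [Dk = D ^ k]: whatever the following signs,
   some partial sum is larger in modulus than
   [r ^ k / (1 - r) + eta / (1 - r) ^ 2] for [r = rho / D] and [eta = h / D]. *)
Fixpoint signed_sums_escape (fuel : nat) (u wk : Z * Z) (rk Dk : Z) : bool :=
  let b := (rk * D * (D - rho) + h * D * Dk)%BZ in
  let m := ((D - rho) * (D - rho))%BZ in
  if (b * b <? m * m * gauss_norm2 u)%BZ then true else
  if fuel is fuel'.+1 then
    let wk' := gauss_mul wk w in
    signed_sums_escape fuel' (D * (u.1 + wk.1), D * (u.2 + wk.2))%BZ wk' (rk * rho)%BZ (Dk * D)%BZ &&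
    signed_sums_escape fuel' (D * (u.1 - wk.1), D * (u.2 - wk.2))%BZ wk' (rk * rho)%BZ (Dk * D)%BZ
  else false.

Hypotheses (rho0 : (0 <? rho)%BZ) (rhoD : (rho <? D)%BZ) (h0 : (0 <=? h)%BZ).

Let d : C := ofZ D.
Let r : C := ofZ rho / d.
Let eta : C := ofZ h / d.
Let om : C := gaussian w / d.

Lemma signed_sums_escapeP fuel k (e : nat -> C) u wk rk Dk :
  (forall i, e i = 1 \/ e i = -1) ->
  gaussian u = d ^+ k * \sum_(i < k) e i * om ^+ i -> gaussian wk = d ^+ k * om ^+ k ->
  ofZ rk = d ^+ k * r ^+ k -> ofZ Dk = d ^+ k ->
  signed_sums_escape fuel u wk rk Dk ->
  exists j, r ^+ j / (1 - r) + eta / (1 - r) ^+ 2 < `|\sum_(i < j) e i * om ^+ i|.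
Proof.
have z0 : ofZ 0 = 0 by [].
have d0 : 0 < d by rewrite -z0 ltr_ofZ; lia.
have dn0 : d != 0 by rewrite gt_eqF.
have rd : ofZ rho = d * r by rewrite /r mulrCA mulfV ?mulr1.
have ed : ofZ h = d * eta by rewrite /eta mulrCA mulfV ?mulr1.
have wd : gaussian w = d * om by rewrite /om mulrCA mulfV ?mulr1.
have r0 : 0 < r by rewrite divr_gt0 // -z0 ltr_ofZ.
have eta0 : 0 <= eta by rewrite divr_ge0 ?(ltW d0) // -z0 ler_ofZ.
have r1 : 0 < 1 - r by rewrite subr_gt0 ltr_pdivrMr // mul1r ltr_ofZ.
(* The escape test is the wanted inequality multiplied by [d ^ q.+2 * (1 - r) ^ 2], which clears
   denominators, then squared, which makes the modulus an integer. *)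
have compare q n : 0 <= n :> C ->
    (d ^+ q * r ^+ q * d * (d - d * r) + d * eta * d * d ^+ q) *
    (d ^+ q * r ^+ q * d * (d - d * r) + d * eta * d * d ^+ q) <
    (d - d * r) * (d - d * r) * ((d - d * r) * (d - d * r)) * `|d ^+ q * n| ^+ 2 ->
    r ^+ q / (1 - r) + eta / (1 - r) ^+ 2 < n.
  move=> n0; set B := _ + _ / _; pose M := d ^+ q.+2 * (1 - r) ^+ 2.
  have M0 : 0 < M by rewrite mulr_gt0 ?exprn_gt0.
  have B0 : 0 <= B by rewrite addr_ge0 // divr_ge0 ?exprn_ge0 // ltW.
  have -> : d ^+ q * r ^+ q * d * (d - d * r) + d * eta * d * d ^+ q = M * B.
    by rewrite /M /B !exprSr; field; rewrite gt_eqF.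
  have -> : (d - d * r) * (d - d * r) * ((d - d * r) * (d - d * r)) * `|d ^+ q * n| ^+ 2 =
      (M * n) ^+ 2.
    by rewrite normrM normrX (ger0_norm (ltW d0)) (ger0_norm n0) /M !exprSr; ring.
  rewrite -expr2 => lt; have : M * B < M * n.
    by move: lt; rewrite ltr_pXn2r // nnegrE mulr_ge0 // ltW.
  by rewrite ltr_pM2l.
have {}compare q (S : C) : (d ^+ q * r ^+ q * d * (d - d * r) + d * eta * d * d ^+ q) *
    (d ^+ q * r ^+ q * d * (d - d * r) + d * eta * d * d ^+ q) <
    (d - d * r) * (d - d * r) * ((d - d * r) * (d - d * r)) * `|d ^+ q * S| ^+ 2 ->
    r ^+ q / (1 - r) + eta / (1 - r) ^+ 2 < `|S|.
  by move=> lt; apply: compare; rewrite // normrM normr_id -normrM.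
move=> e1; elim: fuel k u wk rk Dk => [|fuel IH] k u wk rk Dk hu hw hr hD /=; case: ifPn => [lt _|_] //.
1,2: exists k; move: lt; rewrite -ltr_ofZ !ofZM -normr_gaussian ofZD !ofZM ofZB rd ed -/d hr hD hu.
1,2: exact: compare.
move=> /andP[esc1 esc2].
have hw' : gaussian (gauss_mul wk w) = d ^+ k.+1 * om ^+ k.+1.
  by rewrite gaussianM hw wd !exprSr; ring.
have hr' : ofZ (rk * rho)%BZ = d ^+ k.+1 * r ^+ k.+1.
  by rewrite ofZM hr rd !exprSr; ring.
have hD' : ofZ (Dk * D)%BZ = d ^+ k.+1 by rewrite ofZM hD exprSr.
have gE : gaussian u + e k * gaussian wk = d ^+ k * \sum_(i < k.+1) e i * om ^+ i.
  by rewrite hu hw big_ord_recr /=; ring.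
case: (e1 k) gE => -> gE; [apply: IH _ hw' hr' hD' esc1 | apply: IH _ hw' hr' hD' esc2].
  rewrite exprS -mulrA -gE /gaussian /= !ofZM !ofZD -/d; ring.
rewrite exprS -mulrA -gE /gaussian /= !ofZM !ofZB -/d; ring.
Qed.

End GaussianIntegers.

(** If all roots were at distance at least [eps], the product of the distances would be at least
    [eps] to the degree. *)
Lemma root_near (C : numClosedFieldType) (p : {poly C}) (x eps : C) :
  p \is monic -> 0 < eps -> `|p.[x]| < eps ^+ (size p).-1 ->
  exists2 y, root p y & `|x - y| < eps.
Proof.
move=> mon eps0; have [rs pE] := closed_field_poly_normal p.
rewrite (monicP mon) scale1r in pE.
have [[y ys yx]|far] := pselect (exists2 y, y \in rs & `|x - y| < eps).
  by move=> _; exists y; rewrite // pE root_prod_XsubC.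
rewrite pE size_prod_XsubC /= horner_prod normr_prod => lt.
have : eps ^+ size rs <= \prod_(y <- rs) `|('X - y%:P).[x]|.
  elim: rs far {pE lt} => [|y rs IH] far; first by rewrite big_nil.
  rewrite big_cons exprS ler_pM ?exprn_ge0 ?(ltW eps0) //.
    rewrite !hornerE real_leNgt ?normr_real ?gtr0_real //.
    by apply/negP => h; apply: far; exists y; rewrite // inE eqxx.
  by apply: IH => -[z zs h]; apply: far; exists z; rewrite // inE zs orbT.
by move=> /(lt_le_trans lt); rewrite ltxx.
Qed.

Section Escape.
Variables (C : numClosedFieldType) (D rho h : Z) (w : Z * Z) (fuel : nat).
Hypotheses (rho0 : (0 <? rho)%BZ) (rhoD : (rho <? D)%BZ) (h0 : (0 <=? h)%BZ).
Hypothesis hrho : (h <=? rho)%BZ.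
Hypothesis small : (gauss_norm2 w <=? (rho - h) * (rho - h))%BZ.
Hypothesis escape : signed_sums_escape D rho h w fuel (0, 0)%BZ (1, 0)%BZ 1 1.

Lemma signed_sum_neq0 (z : C) (s : nat -> bool) n : (0 < n)%N ->
  `|z - gaussian C w / ofZ C D| <= ofZ C h / ofZ C D ->
  \sum_(i < n) (-1) ^+ s i * z ^+ i != 0.
Proof.
move=> n0 zw; apply/eqP => S0.
have z0 : ofZ C 0 = 0 by [].
have o1 : ofZ C 1 = 1 by [].
have d0 : 0 < ofZ C D by rewrite -z0 ltr_ofZ; lia.
pose r : C := ofZ C rho / ofZ C D.
have r0 : 0 < r by rewrite divr_gt0 // -z0 ltr_ofZ.
have r1 : r < 1 by rewrite ltr_pdivrMr // mul1r ltr_ofZ.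
have w1 : `|gaussian C w / ofZ C D| <= r - ofZ C h / ofZ C D.
  rewrite normf_div (ger0_norm (ltW d0)) -mulrBl ler_wpM2r ?invr_ge0 ?(ltW d0) //.
  rewrite -ofZB -(@ler_pXn2r _ 2) ?nnegrE // -?z0 ?ler_ofZ; last by lia.
  by rewrite normr_gaussian expr2 -ofZM ler_ofZ.
have wr : `|gaussian C w / ofZ C D| <= r.
  by apply: le_trans w1 _; rewrite gerBl divr_ge0 ?(ltW d0) // -z0 ler_ofZ.
have zr : `|z| <= r.
  rewrite -[z](subrK (gaussian C w / ofZ C D)) (le_trans (ler_normD _ _)) //.
  by apply: le_trans (lerD zw w1) _; rewrite addrC subrK.
(* The periodic continuation of the signs lets a polynomial of any degree enter the same search
   tree. *)
pose e i : C := (-1) ^+ s (i %% n)%N.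
have epm i : e i = 1 \/ e i = -1.
  by rewrite /e; case: (s _); [right|left]; rewrite ?expr1 ?expr0.
have e1 i : `|e i| <= 1 by case: (epm i) => ->; rewrite ?normrN normr1.
have en i : e (n + i)%N = e i by rewrite /e modnDl.
have {}S0 : \sum_(i < n) e i * z ^+ i = 0.
  by rewrite -[RHS]S0; apply: eq_bigr => i _; rewrite /e modn_small.
have [||||k hk] := @signed_sums_escapeP C D rho h w rho0 rhoD h0 fuel 0 e _ _ _ _ epm _ _ _ _ escape.
- by rewrite big_ord0 mulr0 /gaussian /= z0 mulr0 addr0.
- by rewrite !expr0 mulr1 /gaussian /= z0 o1 mulr0 addr0.
- by rewrite !expr0 mulr1 o1.
- by rewrite expr0 o1.
have := signed_sum_near r0 r1 k n0 e1 en zr wr zw S0.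
by move=> /(lt_le_trans hk); rewrite ltxx.
Qed.

End Escape.

Section GaussianHorner.
Variables (C : numClosedFieldType) (D : Z) (w : Z * Z).

(* The value at [w / D] multiplied by [D ^ size s], together with [D ^ size s]. *)
Fixpoint gauss_horner (s : seq int) : (Z * Z) * Z :=
  if s is x :: s' then
    let: (u, m) := gauss_horner s' in
    let v := gauss_mul u w in
    let m' := (m * D)%BZ in
    ((v.1 + Z_of_int x * m', v.2)%BZ, m')
  else ((0, 0)%BZ, 1%BZ).

Lemma gauss_hornerP s : (0 <? D)%BZ ->
  0 < ofZ C (gauss_horner s).2 /\ gaussian C (gauss_horner s).1 =
    ofZ C (gauss_horner s).2 * horner_rec [seq x%:~R | x <- s] (gaussian C w / ofZ C D).
Proof.
move=> hD; have z0 : ofZ C 0 = 0 by [].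
have o1 : ofZ C 1 = 1 by [].
have d0 : 0 < ofZ C D by rewrite -z0 ltr_ofZ.
elim: s => [|x s] /=; first by rewrite /gaussian /= z0 o1 !mulr0 addr0.
case: (gauss_horner s) => u m /= [m0 uE]; rewrite ofZM mulr_gt0 //; split => //.
have -> : gaussian C ((gauss_mul u w).1 + Z_of_int x * (m * D), (gauss_mul u w).2)%BZ =
    gaussian C (gauss_mul u w) + x%:~R * (ofZ C m * ofZ C D).
  have xE : ofZ C (Z_of_int x) = x%:~R by rewrite /ofZ Z_of_intK.
  by rewrite /gaussian /= !ofZD !ofZM xE; ring.
rewrite gaussianM uE; field; by rewrite gt_eqF.
Qed.

End GaussianHorner.

(** * The witness *)

(** Constant term first. This is the quotient by [s - 1] of [x_12 + x_10], where [x_n] is the tent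
    orbit of 0 written as a polynomial in [s] for the sign pattern of [tent_witness_identity]. *)
Definition witness_coefs : seq int := [:: -2; 0; -2; -2; -4; -4; -4; -2; 0; 0; 1].
Definition witness : {poly int} := Poly witness_coefs.

Lemma witnessE : witness = witness_coefs :> seq int.
Proof. by apply: (@PolyK _ 1). Qed.

Lemma size_witness : size witness = 11%N.
Proof. by rewrite witnessE. Qed.

Lemma lead_coef_witness : lead_coef witness = 1.
Proof. by rewrite lead_coefE size_witness witnessE. Qed.

Lemma witness_irreducible : irreducible_poly (map_poly intr witness : {poly rat}).
Proof.
apply/irreducible_rat_int/(@eisenstein_crit 2) => //.
- by rewrite size_witness.
- by rewrite lead_coef_witness.
- by rewrite witnessE.
rewrite size_witness witnessE; do 10 case=> //.
Qed.

Section WitnessMap.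
Variable F : numFieldType.

Definition witness_in : {poly F} := map_poly ratr (map_poly intr witness : {poly rat}).

Lemma witness_inE : witness_in = map_poly intr witness.
Proof.
by rewrite /witness_in -map_poly_comp; apply: eq_map_poly => x /=; rewrite ratr_int.
Qed.

Lemma monic_witness_in : witness_in \is monic.
Proof.
rewrite witness_inE monicE lead_coef_map_inj ?lead_coef_witness //; exact: intr_inj.
Qed.

Lemma size_witness_in : size witness_in = 11%N.
Proof. by rewrite witness_inE size_map_inj_poly ?size_witness //; exact: intr_inj. Qed.

Lemma horner_witness (x : F) : witness_in.[x] = horner_rec [seq y%:~R | y <- witness_coefs] x.
Proof. by rewrite witness_inE map_polyE horner_Poly witnessE. Qed.

Lemma horner_witnessE (x : F) : witness_in.[x] =
  x ^+ 10 - 2 * x ^+ 7 - 4 * x ^+ 6 - 4 * x ^+ 5 - 4 * x ^+ 4 - 2 * x ^+ 3 - 2 * x ^+ 2 - 2.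
Proof. rewrite horner_witness /=; ring. Qed.

End WitnessMap.

Lemma witness_rat_monic : (map_poly intr witness : {poly rat}) \is monic.
Proof.
rewrite monicE lead_coef_map_inj ?lead_coef_witness //; exact: intr_inj.
Qed.

Section TentOrbit.
Variables (R : realType) (s : R).

Lemma tent_pos_bounds lo hi l u x : 0 <= lo -> lo <= s <= hi -> 0 <= l -> l <= x <= u ->
  tent s x = 1 - s * x /\ 1 - hi * u <= tent s x <= 1 - lo * l.
Proof.
move=> lo0 /andP[s1 s2] l0 /andP[x1 x2].
have E : tent s x = 1 - s * x by rewrite /tent ger0_norm // (le_trans l0).
have := ler_pM lo0 l0 s1 x1.
have := ler_pM (le_trans lo0 s1) (le_trans l0 x1) s2 x2.
by rewrite E => ? ?; split => //; apply/andP; split; lra.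
Qed.

Lemma tent_neg_bounds lo hi l u x : 0 <= lo -> lo <= s <= hi -> 0 <= l -> l <= - x <= u ->
  tent s x = 1 + s * x /\ 1 - hi * u <= tent s x <= 1 - lo * l.
Proof.
move=> lo0 hs l0 hx; have := tent_pos_bounds lo0 hs l0 hx.
by rewrite /tent normrN mulrN opprK.
Qed.

(* The orbit of the turning point has signs [+ - - - + - - + + + +]. *)
Lemma tent_witness_identity : 83 / 45 <= s <= 190 / 103 ->
  iter 12 (tent s) 0 + iter 10 (tent s) 0 = (s - 1) * (witness_in R).[s].
Proof.
move=> hs; have lo0 : 0 <= 83 / 45 :> R by lra.
have x1 : iter 1 (tent s) 0 = 1 by rewrite /= /tent normr0 mulr0 subr0.
have pos k l u : 0 <= l -> l <= iter k (tent s) 0 <= u ->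
    iter k.+1 (tent s) 0 = 1 - s * iter k (tent s) 0 /\
    1 - 190 / 103 * u <= iter k.+1 (tent s) 0 <= 1 - 83 / 45 * l.
  exact: tent_pos_bounds.
have neg k l u : 0 <= l -> l <= - iter k (tent s) 0 <= u ->
    iter k.+1 (tent s) 0 = 1 + s * iter k (tent s) 0 /\
    1 - 190 / 103 * u <= iter k.+1 (tent s) 0 <= 1 - 83 / 45 * l.
  exact: tent_neg_bounds.
move: (fun k => iter k (tent s) 0) x1 pos neg => x x1 pos neg.
(* Each enclosure is the previous bound rounded outwards to thousandths. Errors grow about 1.84
   times per step, so the interval for [s] must be this narrow: the tenth point is only known to
   exceed 0.031. *)
have [||e2 b2] := pos 1%N 1 1; [clear; lra | move: x1; clear; lra |].
have [||e3 b3] := neg 2%N (844 / 1000) (845 / 1000); [clear; lra | move: b2; clear; lra |].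
have [||e4 b4] := neg 3%N (556 / 1000) (559 / 1000); [clear; lra | move: b3; clear; lra |].
have [||e5 b5] := neg 4%N (25 / 1000) (32 / 1000); [clear; lra | move: b4; clear; lra |].
have [||e6 b6] := pos 5%N (940 / 1000) (954 / 1000); [clear; lra | move: b5; clear; lra |].
have [||e7 b7] := neg 6%N (733 / 1000) (760 / 1000); [clear; lra | move: b6; clear; lra |].
have [||e8 b8] := neg 7%N (351 / 1000) (402 / 1000); [clear; lra | move: b7; clear; lra |].
have [||e9 b9] := pos 8%N (258 / 1000) (353 / 1000); [clear; lra | move: b8; clear; lra |].
have [||e10 b10] := pos 9%N (348 / 1000) (525 / 1000); [clear; lra | move: b9; clear; lra |].
have [||e11 b11] := pos 10%N (31 / 1000) (359 / 1000); [clear; lra | move: b10; clear; lra |].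
have [||e12 _] := pos 11%N (337 / 1000) (943 / 1000); [clear; lra | move: b11; clear; lra |].
rewrite horner_witnessE e12 e11 e10 e9 e8 e7 e6 e5 e4 e3 e2 x1; ring.
Qed.

Lemma tent_witness_orbit : 83 / 45 <= s <= 190 / 103 -> root (witness_in R) s ->
  iter 13 (tent s) 0 = iter 11 (tent s) 0.
Proof.
move=> /tent_witness_identity + /eqP rs; rewrite rs mulr0 => /eqP; rewrite addr_eq0 => /eqP E.
by rewrite (iterS 12) (iterS 10) E /tent normrN.
Qed.

Lemma tent_witness_pcf : 83 / 45 <= s <= 190 / 103 -> root (witness_in R) s ->
  postcritically_finite (tent s) 0.
Proof.
move=> hs rs; have E := tent_witness_orbit hs rs.
have orb n : exists2 m, (m < 13)%N & iter n (tent s) 0 = iter m (tent s) 0.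
  elim: n => [|n [m m13 IH]]; first by exists 0%N.
  rewrite iterS IH -iterS; case: (ltnP m.+1 13) => h; first by exists m.+1.
  by exists 11%N => //; have -> : m.+1 = 13%N by apply/eqP; rewrite eqn_leq m13.
apply: (@sub_finite_set _ _ [set iter m (tent s) 0 | m in `I_13]).
  by move=> _ [n _ <-]; have [m m13 ->] := orb n; exists m.
exact: finite_image (finite_II 13).
Qed.

End TentOrbit.

Lemma witness_real_root (R : realType) :
  exists2 s : R, 83 / 45 <= s <= 190 / 103 & root (witness_in R) s.
Proof.
apply: poly_ivt; first by lra.
by rewrite !horner_witnessE; apply/andP; split; lra.
Qed.


(** * Certified location of the complex root *)

Section WitnessApproximation.
Variable C : numClosedFieldType.
Implicit Types x y q m n d : Z.

Lemma ofZ_gt0 n : (0 <? n)%BZ -> 0 < ofZ C n.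
Proof. by rewrite -(ltr_ofZ C). Qed.

Lemma ofZX m k : ofZ C (m ^ Z.of_nat k)%BZ = ofZ C m ^+ k.
Proof.
elim: k => // k IH; rewrite Nat2Z.inj_succ Z.pow_succ_r; last exact: Nat2Z.is_nonneg.
by rewrite ofZM IH exprS.
Qed.

Lemma normr_gaussian_lt u n : (0 <=? n)%BZ -> (gauss_norm2 u <? n * n)%BZ ->
  `|gaussian C u| < ofZ C n.
Proof.
move=> n0 un; have n0' : 0 <= ofZ C n by rewrite -[0]/(ofZ C 0) ler_ofZ.
by rewrite -(@ltr_pXn2r _ 2) ?nnegrE // normr_gaussian expr2 -ofZM ltr_ofZ.
Qed.

Lemma gaussian_scale x y n : gaussian C (x * n, y * n)%BZ = gaussian C (x, y) * ofZ C n.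
Proof. by rewrite /gaussian !ofZM mulrDl mulrA. Qed.

Lemma gaussianB x y x' y' :
  gaussian C (x - x', y - y')%BZ = gaussian C (x, y) - gaussian C (x', y').
Proof. by rewrite /gaussian !ofZB /=; ring. Qed.

Lemma gaussian_dist_lt d q m n x y x' y' :
  (0 <? d)%BZ -> (0 <? q)%BZ -> (0 <? m)%BZ -> (0 <=? n)%BZ ->
  (gauss_norm2 ((x * q - x') * m, (y * q - y') * m) <? n * (d * q) * (n * (d * q)))%BZ ->
  `|gaussian C (x, y) / ofZ C d - gaussian C (x', y') / ofZ C (d * q)%BZ| < ofZ C n / ofZ C m.
Proof.
move=> d0 q0 m0 n0 lt.
have [d0' q0' m0'] : [/\ 0 < ofZ C d, 0 < ofZ C q & 0 < ofZ C m] by split; apply: ofZ_gt0.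
have dq0 : 0 < ofZ C (d * q)%BZ by rewrite ofZM mulr_gt0.
have -> : gaussian C (x, y) / ofZ C d - gaussian C (x', y') / ofZ C (d * q)%BZ =
    gaussian C (x * q - x', y * q - y')%BZ / ofZ C (d * q)%BZ.
  rewrite gaussianB gaussian_scale mulrBl; congr (_ - _).
  by rewrite ofZM -mulf_div divff ?mulr1 ?gt_eqF.
rewrite normf_div (gtr0_norm dq0) ltr_pdivrMr // mulrAC ltr_pdivlMr //.
rewrite -[X in _ * X < _](gtr0_norm m0') -normrM -gaussian_scale -ofZM.
by apply: normr_gaussian_lt lt; lia.
Qed.

Lemma witness_value_lt d w m : (0 <? d)%BZ -> (0 <? m)%BZ ->
  (let t := gauss_horner d w witness_coefs in
   gauss_norm2 (t.1.1 * m, t.1.2 * m) <? t.2 * t.2)%BZ ->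
  `|(witness_in C).[gaussian C w / ofZ C d]| < (ofZ C m)^-1.
Proof.
move=> d0 m0; have [] := gauss_hornerP C w witness_coefs d0.
rewrite -horner_witness; case: (gauss_horner _ _ _) => -[u1 u2] t /= t0 uE lt.
have m0' := ofZ_gt0 m0.
rewrite -(ltr_pM2l t0) -[X in X * `|_|](gtr0_norm t0) -normrM -uE ltr_pdivlMr //.
rewrite -[X in _ * X < _](gtr0_norm m0') -normrM -gaussian_scale.
by apply: normr_gaussian_lt lt; move: t0; rewrite -[0]/(ofZ C 0) ltr_ofZ; lia.
Qed.

Lemma witness_root_near d w m : (0 <? d)%BZ -> (0 <? m)%BZ ->
  (let t := gauss_horner d w witness_coefs in
   let e := m ^ 10 in
   gauss_norm2 (t.1.1 * e, t.1.2 * e) <? t.2 * t.2)%BZ ->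
  exists2 z, root (witness_in C) z & `|gaussian C w / ofZ C d - z| < (ofZ C m)^-1.
Proof.
move=> d0 m0 lt; have m0' := ofZ_gt0 m0.
apply: root_near (monic_witness_in C) _ _; first by rewrite invr_gt0.
rewrite size_witness_in exprVn -(ofZX m 10); apply: witness_value_lt => //.
by lia.
Qed.

End WitnessApproximation.

(* The coarse approximation [(x + i y) / d] keeps the integers of the tree search
   small; the fine one is needed since [root_near] only guarantees a distance of
   the order of the tenth root of the value of the polynomial. *)
Lemma witness_isolated_root (C : numClosedFieldType) :
  exists z eps : C, [/\ root (witness_in C) z, 0 < eps &
    forall y (s : nat -> bool) n, (0 < n)%N -> `|z - y| < eps ->
      \sum_(i < n) (-1) ^+ s i * y ^+ i != 0].
Proof.
have [d [dE dgt0]] : exists d, d = 10000%BZ /\ (0 <? d)%BZ by exists 10000%BZ.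
(* In degree 10, a root within [1 / m = 10^-5] requires a value below [10^-50], hence the 52
   decimals given by [d * q]. *)
have [q [qE qgt0]] : exists q, q = (10 ^ 48)%BZ /\ (0 <? q)%BZ by eexists.
have [m [mE mgt0]] : exists m, m = (100000)%BZ /\ (0 <? m)%BZ by eexists.
have [x xE] : exists x, x = 5026%BZ by eexists.
have [y yE] : exists y, y = 5320%BZ by eexists.
have [x' xE'] : exists x', x' = 5025610479880239531771111273965264830179798347972937%BZ by eexists.
have [y' yE'] : exists y', y' = 5319928745550146738708641193975542493672991813693014%BZ by eexists.
have near : `|gaussian C (x, y) / ofZ C d - gaussian C (x', y') / ofZ C (d * q)%BZ| <
    ofZ C 4 / ofZ C m.
  by apply: gaussian_dist_lt; rewrite ?dE ?qE ?mE ?xE ?yE ?xE' ?yE'; vm_compute.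
have [z rz zx] : exists2 z, root (witness_in C) z &
    `|gaussian C (x', y') / ofZ C (d * q)%BZ - z| < (ofZ C m)^-1.
  by apply: witness_root_near; rewrite ?dE ?qE ?mE ?xE' ?yE'; vm_compute.
have m0 : 0 < ofZ C m by apply: ofZ_gt0.
have d0 : 0 < ofZ C d by apply: ofZ_gt0.
have o5 : 0 < ofZ C 5 by apply: ofZ_gt0.
have zw : `|gaussian C (x, y) / ofZ C d - z| < ofZ C 5 / ofZ C m.
  rewrite -(subrKA (gaussian C (x', y') / ofZ C (d * q)%BZ)).
  apply: le_lt_trans (ler_normD _ _) _.
  have -> : ofZ C 5 = ofZ C 4 + 1 by rewrite -[1]/(ofZ C 1) -ofZD.
  by rewrite (mulrDl (ofZ C 4)) [X in _ < _ + X]mul1r ltrD.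
exists z, (ofZ C 5 / ofZ C m); split => //; first by rewrite divr_gt0.
move=> u s n n0 zu.
(* The root lies within [5 / m] of the coarse centre and [u] within [5 / m] of the root, so the disk
   of radius [1 / d] searched by the tree contains [u]. *)
have h1 : ofZ C 1 / ofZ C d = ofZ C 5 / ofZ C m + ofZ C 5 / ofZ C m.
  have -> : m = (10 * d)%BZ by rewrite mE dE.
  rewrite ofZM -mulrDl -ofZD; have -> : (5 + 5 = 10)%BZ by [].
  by rewrite invfM mulrA divff // gt_eqF // ofZ_gt0.
have close : `|u - gaussian C (x, y) / ofZ C d| <= ofZ C 1 / ofZ C d.
  rewrite h1 distrC -(subrKA z); apply: le_trans (ler_normD _ _) _.
  by rewrite ltW // ltrD.
(* The Gaussian integer [(x, y)] has modulus about 7318.7, so 7325 leaves room for [h = 1] and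
   [r = 0.7325] bounds the moduli in the disk. *)
by apply: (@signed_sum_neq0 C d 7325 1 (x, y) 18) n0 close;
  rewrite ?dE ?xE ?yE; vm_compute.
Qed.

Theorem theorem5 (R : realType) : Omega_cp R <> Omega_pcf R.
Proof.
have [z [eps [rz eps0 isolated]]] := witness_isolated_root R[i].
have [s hs rs] := witness_real_root R.
have [s1 s2] : 1 < s /\ s <= 2 by split; move: hs; clear; lra.
have pcf : conjugates_pcf R z.
  exists (1 - s), 1, (tent s), 0, s; split.
  - exact: tent_unimodal.
  - exact: tent_witness_pcf.
  - exact: tent_growth_rate.
  exists (map_poly intr witness); last exact: rz.
  exact: minimal_polynomial_irreducible witness_rat_monic witness_irreducible rs.
(* If the closures agreed, the disk about [z] would contain a conjugate from the critically periodic
   family, a zero of a signed sum. *)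
move=> E; have : Omega_pcf R z by apply: subset_closure.
rewrite -E => /(_ (ball (z : R[i]^o) eps)) [].
  exact: nbhsx_ballx.
move=> y [/conjugates_cp_signed_sum[p [t p0 S0]]].
rewrite -ball_normE /= => /(isolated y t p p0).
by rewrite S0 eqxx.
Qed.
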